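(* Let $1\le k<n$, $r=n-k$, $E=\mathbb C^n$, $X=G(k,n)$. Let $d\ge 0$ be an integer and let $\lambda,\mu,\nu$ be partitions contained in the $k\times r$ rectangle with $|\lambda|+|\mu|+|\nu|=kr+nd$. Let $F_\bullet,G_\bullet,H_\bullet$ be complete flags of $E$ in general position. Then the map $f\mapsto(\operatorname{Ker}(f),\operatorname{Span}(f))$ is a bijection from the set of morphisms $f\colon\mathbb P^1\to X$ of degree $d$ satisfying $f(0)\in X_\lambda(F_\bullet)$, $f(1)\in X_\mu(G_\bullet)$, $f(\infty)\in X_\nu(H_\bullet)$ onto the set of points of $X^{(d)}_\lambda(F_\bullet)\cap X^{(d)}_\mu(G_\bullet)\cap X^{(d)}_\nu(H_\bullet)\subset Y_d=F(k-d,k+d;n)$. (In particular, every such $f$ has $\dim\operatorname{Ker}(f)=k-d$ and $\dim\operatorname{Span}(f)=k+d$.)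
   Context: For a complete flag $F_1\subset\cdots\subset F_n=E$ and a partition $\lambda=(\lambda_1\ge\cdots\ge\lambda_k\ge0)$ with $\lambda_1\le r$, the Schubert variety is $X_\lambda(F_\bullet)=\{V\in X:\dim(V\cap F_{r+i-\lambda_i})\ge i\ \forall\,1\le i\le k\}$, of codimension $|\lambda|=\sum\lambda_i$; $\sigma_\lambda$ denotes its class. The degree of $f\colon\mathbb P^1\to X$ is $\int f_*[\mathbb P^1]\cdot\sigma_1$. For $f$, $\operatorname{Ker}(f)=\bigcap_{V\in f(\mathbb P^1)}V$ and $\operatorname{Span}(f)=\sum_{V\in f(\mathbb P^1)}V$ (intersection and linear span of the subspaces of $E$ corresponding to points of the image). $F(a,b;n)$ is the two-step flag variety of pairs $A\subset B\subset E$ with $\dim A=a$, $\dim B=b$ (empty unless $0\le a\le b\le n$), and $Y_d=F(k-d,k+d;n)$. For a subvariety $\mathcal W\subset X$, $\mathcal W^{(d)}=\{(A,B)\in Y_d:\exists V\in\mathcal W,\ A\subset V\subset B\}$; $X^{(d)}_\lambda(F_\bullet)$ denotes $(X_\lambda(F_\bullet))^{(d)}$. *)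

(* Defs.v *)
From HB Require Import structures.
From mathcomp Require Import all_boot all_order all_algebra.
From mathcomp Require Import reals.
From mathcomp.real_closed Require Export complex.
From mathcomp Require Import mpoly.
Set Implicit Arguments.
Unset Strict Implicit.
Unset Printing Implicit Defensive.
Import Order.TTheory GRing.Theory Num.Theory.
Local Open Scope ring_scope.

Section Defs.
Variable R : realType.
Local Notation C := R[i].

(* Subspaces of E = C^n are represented as row spaces of matrices
   (mxalgebra, %MS); equality of subspaces is (_ == _)%MS. *)

Definition is_part (k r : nat) (lam : seq nat) : Prop :=
  size lam = k /\ sorted geq lam /\ all (fun a => a <= r)%N lam.

(* lambda_i for 1 <= i <= k *)
Definition part_at (lam : seq nat) (i : nat) : nat := nth 0%N lam i.-1.

(* A complete flag is given by an invertible matrix M: F_j = span of the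
   first j rows of M. *)
Definition flagsp (n : nat) (M : 'M[C]_n) (j : nat) : 'M[C]_n :=
  \matrix_(a, b) (if (a < j)%N then M a b else 0).

Definition inSchubert (n k : nat) (lam : seq nat) (F : 'M[C]_n) (V : 'M[C]_n) : Prop :=
  \rank V = k /\
  forall i : nat, (1 <= i <= k)%N ->
    (i <= \rank (V :&: flagsp F ((n - k) + i - part_at lam i))%MS)%N.

(* (A,B) in Y_d = F(k-d, k+d; n) (empty unless 0 <= k-d <= k+d <= n). *)
Definition inYd (n k d : nat) (A B : 'M[C]_n) : Prop :=
  (d <= k)%N /\ (k + d <= n)%N /\
  \rank A = (k - d)%N /\ \rank B = (k + d)%N /\ (A <= B)%MS.

Definition inSchubertD (n k d : nat) (lam : seq nat) (F : 'M[C]_n) (A B : 'M[C]_n) : Prop :=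
  inYd k d A B /\ exists V : 'M[C]_n, inSchubert k lam F V /\ (A <= V)%MS /\ (V <= B)%MS.

(* Points of P^1: Some t (t in C) and None (= infinity). *)
Definition evalmx (k n : nat) (M : 'M[{poly C}]_(k, n)) (t : C) : 'M[C]_(k, n) :=
  map_mx (fun p => p.[t]) M.

(* degree of the Pluecker map of a polynomial k x n matrix: max degree of
   its maximal minors *)
Definition pl_deg (k n : nat) (M : 'M[{poly C}]_(k, n)) : nat :=
  \max_(g : {ffun 'I_k -> 'I_n}) (size (\det (colsub g M))).-1.

(* f : P^1 -> G(k,n) is a morphism of degree d: on each standard affine
   chart of P^1 it is given by a polynomial k x n matrix of rank k at every
   point; the degree is the degree of the Pluecker embedding of f. *)
Definition morphism_deg (n k d : nat) (f : option C -> 'M[C]_n) : Prop :=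
  exists M N : 'M[{poly C}]_(k, n),
    (forall t : C, \rank (evalmx M t) = k /\ (evalmx M t == f (Some t))%MS) /\
    (forall s : C, \rank (evalmx N s) = k /\
        (evalmx N s == f (if s == 0 then None else Some s^-1))%MS) /\
    pl_deg M = d.

Definition isKer (n : nat) (f : option C -> 'M[C]_n) (A : 'M[C]_n) : Prop :=
  (forall x, (A <= f x)%MS) /\
  (forall T : 'M[C]_n, (forall x, (T <= f x)%MS) -> (T <= A)%MS).

Definition isSpan (n : nat) (f : option C -> 'M[C]_n) (B : 'M[C]_n) : Prop :=
  (forall x, (f x <= B)%MS) /\
  (forall T : 'M[C]_n, (forall x, (f x <= T)%MS) -> (B <= T)%MS).

Definition flag_coords (n : nat) (F G H : 'M[C]_n) : 'I_(n * n + n * n + n * n) -> C :=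
  fun j => (row_mx (row_mx (mxvec F) (mxvec G)) (mxvec H)) 0 j.

Definition kerspan_bij (n k d : nat) (lam mu nu : seq nat) (F G H : 'M[C]_n) : Prop :=
  let S := fun f : option C -> 'M[C]_n =>
     morphism_deg k d f /\ inSchubert k lam F (f (Some 0)) /\
     inSchubert k mu G (f (Some 1)) /\ inSchubert k nu H (f None) in
  let T := fun A B : 'M[C]_n =>
     inSchubertD k d lam F A B /\ inSchubertD k d mu G A B /\ inSchubertD k d nu H A B in
  (forall f, S f -> forall A B, isKer f A -> isSpan f B -> T A B) /\
  (forall f g, S f -> S g -> forall A B,
       isKer f A -> isSpan f B -> isKer g A -> isSpan g B ->
       forall x, (f x == g x)%MS) /\
  (forall A B, T A B -> exists f, S f /\ isKer f A /\ isSpan f B).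

End Defs.

(* Main.v *)
Require Import Defs.
From HB Require Import structures.
From mathcomp Require Import all_boot all_order all_algebra.
From mathcomp Require Import reals.
From mathcomp.real_closed Require Import complex.
From mathcomp Require Import perm mpoly zify.
Set Implicit Arguments.
Unset Strict Implicit.
Unset Printing Implicit Defensive.
Import Order.TTheory GRing.Theory Num.Theory.
Local Open Scope ring_scope.

(** Generic position enters only through a dimension count.  Suppose A <= V1, V2, V3 <= B with
    the V's in the three Schubert varieties, dim A = k - x and dim B = k + y.  The triples of
    flags admitting such a configuration are covered by finitely many polynomial images of affine
    spaces of dimension 3 n^2 - ((n - k) (d - y) + k (d - x) + (x - y)^2), and M > N polynomials
    in N variables are algebraically dependent; so generically no configuration with x, y <= d
    exists unless x = y = d.  In the latter case V1, V2, V3 meet pairwise exactly in A,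
    since a common larger subspace costs one more parameter.

    A morphism of degree d is given by a polynomial matrix; after row reduction its row degrees
    add up to at most d, whence dim Ker >= k - d and dim Span <= k + d.  In the extremal case it
    is a pencil A + <p + t q>, which is determined by its values at 0, 1 and infinity, and
    conversely three spaces V1, V2, V3 meeting pairwise in A lie on such a pencil.
    Finally V1 is determined by (A, B): two choices would span a pencil inside the
    Schubert variety, one of whose members meets V2 in more than A. *)

(** * Algebraic dependence of more polynomials than variables *)

Section AlgebraicDependence.
Variable K : fieldType.

(** A bound [msize p <= x.+1] says that the degree is at most x, so such bounds add under products;
    the zero polynomial, of size 0, satisfies all of them. *)
Lemma msize_prod_exp (N M : nat) (phi : 'I_M -> {mpoly K[N]}) (e D : nat)
    (m : 'I_M -> nat) :
  (forall j, (msize (phi j) <= e.+1)%N) -> (forall j, (m j <= D)%N) ->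
  (msize (\prod_j phi j ^+ m j) <= (M * (D * e)).+1)%N.
Proof.
move=> Hphi Hm.
have HM (p q : {mpoly K[N]}) x y :
    (msize p <= x.+1)%N -> (msize q <= y.+1)%N -> (msize (p * q) <= (x + y).+1)%N.
  move=> Hp Hq; have [->|p0] := eqVneq p 0; first by rewrite mul0r msize0.
  have [->|q0] := eqVneq q 0; first by rewrite mulr0 msize0.
  rewrite msizeM //; move: (msize p) (msize q) Hp Hq => s t Hs Ht; lia.
have HX (p : {mpoly K[N]}) i : (msize p <= e.+1)%N -> (msize (p ^+ i) <= (i * e).+1)%N.
  move=> Hp; elim: i => [|i IH]; first by rewrite expr0 msize1.
  by rewrite exprS mulSn; exact: HM.
suff: (msize (\prod_j phi j ^+ m j) <= (\sum_(j < M) D * e).+1)%N.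
  by rewrite sum_nat_const card_ord.
elim/big_ind2: _ => [|p x q y|j _]; first by rewrite msize1.
- exact: HM.
- by apply: leq_trans (HX _ _ (Hphi j)) _; rewrite ltnS leq_mul2r Hm orbT.
Qed.

(* There are (D+1)^M monomials of degree at most D in each variable, and their
   values at phi span a space of dimension at most (M D e + 1)^N. *)
Lemma alg_dependent (N M : nat) (phi : 'I_M -> {mpoly K[N]}) :
  (N < M)%N ->
  exists P : {mpoly K[M]}, P != 0 /\
    forall v, P.@[fun j => (phi j).@[v]] = 0.
Proof.
move=> ltNM.
pose e := (\max_j msize (phi j))%N.
have He j : (msize (phi j) <= e.+1)%N.
  by apply: leqW; apply: (leq_bigmax_cond (F := fun j => msize (phi j))).
(* With this D, Q^N <= ((M e + 1)(D + 1))^N = D (D + 1)^N < (D + 1)^(N + 1) <= (D + 1)^M. *)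
pose D := ((M * e).+1 ^ N)%N.
pose Q := (M * (D * e)).+1.
pose row_t : finType := {ffun 'I_M -> 'I_D.+1}.
pose col_t : finType := {ffun 'I_N -> 'I_Q}.
have Hcard : (#|col_t| < #|row_t|)%N.
  rewrite !card_ffun !card_ord.
  apply: (@leq_ltn_trans (((M * e).+1 * D.+1) ^ N)%N).
    have HQ : (Q <= (M * e).+1 * D.+1)%N by rewrite /Q; nia.
    by case: (posnP N) => [->|N0]; [rewrite !expn0 | rewrite leq_exp2r].
  rewrite expnMn; apply: (@leq_trans (D.+1 ^ N.+1)%N); last by rewrite leq_exp2l // ltnS expn_gt0.
  by rewrite expnS ltn_pmul2r // expn_gt0.
pose psi (m : row_t) : {mpoly K[N]} := \prod_j phi j ^+ m j.
pose cm (g : col_t) : 'X_{1..N} := [multinom (g i : nat) | i < N].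
pose A : 'M[K]_(#|row_t|, #|col_t|) :=
  \matrix_(i, j) (psi (enum_val i))@_(cm (enum_val j)).
have [c cA c0] : exists2 c : 'rV_(#|row_t|), c *m A = 0 & c != 0.
  have : ~~ row_free A by rewrite /row_free neq_ltn (leq_ltn_trans (rank_leq_col A) Hcard).
  rewrite -kermx_eq0 => /rowV0Pn[v /sub_kermxP vA v0]; by exists v.
pose rm (m : row_t) : 'X_{1..M} := [multinom (m i : nat) | i < M].
have rm_inj : injective rm.
  move=> m1 m2 /mnmP E; apply/ffunP=> i; apply: val_inj.
  by have := E i; rewrite !mnmE.
exists (\sum_i c 0 i *: 'X_[rm (enum_val i)]); split.
  case/rV0Pn: c0 => i0 ci0; apply: contra_neq ci0 => P0.
  have := congr1 (mcoeff (rm (enum_val i0))) P0.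
  rewrite mcoeff0 raddf_sum /= (bigD1 i0) //= mcoeffZ mcoeffX eqxx mulr1 big1 ?addr0 //.
  move=> i ne; rewrite mcoeffZ mcoeffX; case: eqP => [/rm_inj/enum_val_inj E|]; last by rewrite mulr0.
  by rewrite E eqxx in ne.
(* Monomials of degree below Q are among the columns of [A]; those of larger degree do not occur in
   any [psi]. *)
have S0 : \sum_i c 0 i *: psi (enum_val i) = 0.
  apply/mpolyP=> m; rewrite mcoeff0 raddf_sum /=.
  case: (ltnP (mdeg m) Q) => Hm.
    have Hi (i : 'I_N) : (m i < Q)%N.
      apply: leq_ltn_trans Hm; rewrite mdegE (bigD1 i) //=; exact: leq_addr.
    pose g : col_t := [ffun i => Ordinal (Hi i)].
    have -> : m = cm g by apply/mnmP=> i; rewrite mnmE ffunE.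
    have := congr1 (fun B : 'rV_#|col_t| => B 0 (enum_rank g)) cA.
    rewrite !mxE => cA0; rewrite -[RHS]cA0; apply: eq_bigr => i _.
    by rewrite mcoeffZ !mxE enum_rankK.
  rewrite big1 // => i _; rewrite mcoeffZ memN_msupp_eq0 ?mulr0 //.
  apply: msize_mdeg_ge; apply: leq_trans Hm.
  by apply: msize_prod_exp => // j; rewrite -ltnS.
move=> v; have := congr1 (meval v) S0.
rewrite meval0 !raddf_sum /= => S0v; rewrite -[RHS]S0v; apply: eq_bigr => i _.
rewrite !mevalZ mevalX rmorph_prod /=; congr (_ * _); apply: eq_bigr => j _.
by rewrite mnmE rmorphXn.
Qed.

End AlgebraicDependence.

(** * Polynomial functions and matrices on an affine space *)

Section PolynomialMaps.
Variables (K : fieldType) (I : finType).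

(** The variables are indexed by any finite type, so that parameter spaces can be disjoint sums of
    coordinate sets. *)
Definition polyfun (f : (I -> K) -> K) : Prop :=
  exists p : {mpoly K[#|I|]}, forall x, f x = p.@[fun i => x (enum_val i)].

Definition polymx (m n : nat) (Phi : (I -> K) -> 'M[K]_(m, n)) : Prop :=
  forall i j, polyfun (fun x => Phi x i j).

Lemma polyfun_ext (f g : (I -> K) -> K) : f =1 g -> polyfun g -> polyfun f.
Proof. by move=> E [p Hp]; exists p => x; rewrite E. Qed.

Lemma polyfun_const c : polyfun (fun=> c).
Proof. by exists c%:MP => x; rewrite mevalC. Qed.

Lemma polyfun_coord i : polyfun (fun x => x i).
Proof. by exists 'X_(enum_rank i) => x; rewrite mevalXU enum_rankK. Qed.

Lemma polyfunD f g : polyfun f -> polyfun g -> polyfun (fun x => f x + g x).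
Proof. by move=> [p Hp] [q Hq]; exists (p + q) => x; rewrite mevalD Hp Hq. Qed.

Lemma polyfunM f g : polyfun f -> polyfun g -> polyfun (fun x => f x * g x).
Proof. by move=> [p Hp] [q Hq]; exists (p * q) => x; rewrite mevalM Hp Hq. Qed.

Lemma polyfun_sum (J : finType) (f : J -> (I -> K) -> K) :
  (forall j, polyfun (f j)) -> polyfun (fun x => \sum_j f j x).
Proof.
move=> Hf; elim: (index_enum J) => [|j r IH].
  by apply: polyfun_ext (polyfun_const 0) => x; rewrite big_nil.
by apply: polyfun_ext (polyfunD (Hf j) IH) => x; rewrite big_cons.
Qed.

Lemma polymxD m n (Phi Psi : (I -> K) -> 'M[K]_(m, n)) :
  polymx Phi -> polymx Psi -> polymx (fun x => Phi x + Psi x).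
Proof.
move=> HP HQ i j; apply: polyfun_ext (polyfunD (HP i j) (HQ i j)) => x.
by rewrite mxE.
Qed.

Lemma polymxM m n p (Phi : (I -> K) -> 'M[K]_(m, n))
    (Psi : (I -> K) -> 'M[K]_(n, p)) :
  polymx Phi -> polymx Psi -> polymx (fun x => Phi x *m Psi x).
Proof.
move=> HP HQ i j.
apply: (@polyfun_ext _ (fun x => \sum_l Phi x i l * Psi x l j)).
  by move=> x; rewrite mxE.
by apply: polyfun_sum => l; apply: polyfunM.
Qed.

Lemma polymx_col m1 m2 n (Phi : (I -> K) -> 'M[K]_(m1, n))
    (Psi : (I -> K) -> 'M[K]_(m2, n)) :
  polymx Phi -> polymx Psi -> polymx (fun x => col_mx (Phi x) (Psi x)).
Proof.
move=> HP HQ i j; case: (split_ordP i) => l ->.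
  by apply: polyfun_ext (HP l j) => x; rewrite col_mxEu.
by apply: polyfun_ext (HQ l j) => x; rewrite col_mxEd.
Qed.

End PolynomialMaps.

(** * Affine families of matrices with prescribed entries *)

Section MaskedMatrices.
Variables (K : fieldType) (m n : nat) (mask : pred ('I_m * 'I_n)).

(** Parametrizes by an affine space the matrices that agree with [c] off the mask; its dimension is
    the size of the mask. *)
Definition maskmx (c : 'M[K]_(m, n)) (y : {s | mask s} -> K) : 'M[K]_(m, n) :=
  \matrix_(i, j) (if insub (i, j) is Some s then y s else c i j).

Lemma polymx_mask (I : finType) c (h : {s | mask s} -> I) :
  polymx (fun x => maskmx c (x \o h)).
Proof.
move=> i j; case E: (insub (i, j) : option {s | mask s}) => [s|].
  by apply: polyfun_ext (polyfun_coord K (h s)) => x; rewrite mxE E.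
by apply: polyfun_ext (polyfun_const _ (c i j)) => x; rewrite mxE E.
Qed.

Lemma maskmx_surj (c M : 'M[K]_(m, n)) :
  (forall i j, ~~ mask (i, j) -> M i j = c i j) -> exists y, M = maskmx c y.
Proof.
move=> HM; exists (fun s => M (val s).1 (val s).2); apply/matrixP=> i j.
rewrite mxE; case: insubP => [s _ -> //|]; exact: HM.
Qed.

End MaskedMatrices.

(** * Sets of flag triples contained in a hypersurface *)

Section Thin.
Variables (R : realType) (n : nat).
Local Notation C := R[i].

(* The orderings of the three flags are the ones in which each pair of flags
   comes first once. *)
Definition arrange (s : nat) (F G H : 'M[C]_n) : 'I_(n * n + n * n + n * n) -> C :=
  match s with
  | 0%N => flag_coords F G H
  | 1%N => flag_coords F H G
  | _ => flag_coords H G F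
  end.

(** Stands in for positive codimension: it passes to subsets and finite unions, and holds for
    polynomial images of affine spaces of too small dimension. *)
Definition thin (s : nat) (S : 'M[C]_n -> 'M[C]_n -> 'M[C]_n -> Prop) : Prop :=
  exists P : {mpoly C[n * n + n * n + n * n]}, P != 0 /\
    forall F G H, S F G H -> P.@[arrange s F G H] = 0.

Lemma thin_sub s (S S' : 'M[C]_n -> 'M[C]_n -> 'M[C]_n -> Prop) :
  (forall F G H, S F G H -> S' F G H) -> thin s S' -> thin s S.
Proof. by move=> H [P [P0 HP]]; exists P; split=> // F G H' /H /HP. Qed.

Lemma thin_exists s (T : finType) (S : T -> 'M[C]_n -> 'M[C]_n -> 'M[C]_n -> Prop) :
  (forall t, thin s (S t)) -> thin s (fun F G H => exists t, S t F G H).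
Proof.
move=> HS; have [P HP] := fin_all_exists HS.
exists (\prod_t P t); split; first by apply/prodf_neq0 => t _; case: (HP t).
move=> F G H [t St]; rewrite rmorph_prod /= (bigD1 t) //= (HP t).2 //.
by rewrite mul0r.
Qed.

Lemma thin_guard s (Q : bool) (S : 'M[C]_n -> 'M[C]_n -> 'M[C]_n -> Prop) :
  (Q -> thin s S) -> thin s (fun F G H => Q /\ S F G H).
Proof.
case: Q => HS; first by apply: thin_sub (HS isT) => F G H [].
by exists 1; split; [exact: oner_neq0 | move=> F G H []].
Qed.

Lemma polyfun_flag_coords (I : finType) (F G H : (I -> C) -> 'M[C]_n) j :
  polymx F -> polymx G -> polymx H ->
  polyfun (fun x => flag_coords (F x) (G x) (H x) j).
Proof.
move=> HF HG HH.
have Hv (E : (I -> C) -> 'M[C]_n) l : polymx E -> polyfun (fun x => mxvec (E x) 0 l).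
  move=> HE; case/mxvec_indexP: l => a b.
  by apply: polyfun_ext (HE a b) => x; rewrite mxvecE.
case: (split_ordP j) => l ->.
  case: (split_ordP l) => l' ->.
    by apply: polyfun_ext (Hv F l' HF) => x; rewrite /flag_coords !row_mxEl.
  by apply: polyfun_ext (Hv G l' HG) => x; rewrite /flag_coords row_mxEl row_mxEr.
by apply: polyfun_ext (Hv H l HH) => x; rewrite /flag_coords row_mxEr.
Qed.

(** The 3 n^2 entries are polynomials in fewer variables, so [alg_dependent] gives a nontrivial
    equation between them. *)
Lemma thin_image s (I : finType) (F G H : (I -> C) -> 'M[C]_n) :
  (#|I| < n * n + n * n + n * n)%N -> polymx F -> polymx G -> polymx H ->
  thin s (fun F' G' H' => exists x, [/\ F' = F x, G' = G x & H' = H x]).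
Proof.
move=> ltI HF HG HH.
have Hp j : polyfun (fun x => arrange s (F x) (G x) (H x) j).
  by case: s => [|[|s]] /=; apply: polyfun_flag_coords.
have [phi Hphi] := fin_all_exists Hp.
have [P [P0 HP]] := alg_dependent phi ltI.
exists P; split=> // _ _ _ [x [-> -> ->]].
by rewrite -[RHS](HP (fun i => x (enum_val i))); apply: meval_eq => j; rewrite Hphi.
Qed.

End Thin.

(** * Affine charts for chains of subspaces *)

Section Charts.
Variable K : fieldType.

Lemma full_minor (m b : nat) (W : 'M[K]_(m, b)) :
  row_free W ->
  exists2 g : {ffun 'I_m -> 'I_b}, injective g & colsub g W \in unitmx.
Proof.
move=> Wfree; have WTfull : row_full W^T by rewrite /row_full mxrank_tr.
exists (fullrankfun WTfull); first exact: fullrankfun_inj.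
by rewrite -unitmx_tr trmx_mxsub fullrowsub_unit.
Qed.

(** The coordinate subspace of Z, given as a projector: multiplication by it on the right clears the
    columns outside Z, on the left the rows outside Z. *)
Definition coordsp (b : nat) (Z : {set 'I_b}) : 'M[K]_b :=
  diag_mx (\row_j (j \in Z)%:R).

Lemma coordspE (b : nat) (Z : {set 'I_b}) m (M : 'M[K]_(m, b)) i j :
  (M *m coordsp Z) i j = M i j * (j \in Z)%:R.
Proof. by rewrite mul_mx_diag !mxE. Qed.

Lemma sub_coordspP (b : nat) (Z : {set 'I_b}) m (M : 'M[K]_(m, b)) :
  reflect (forall i j, j \notin Z -> M i j = 0) (M <= coordsp Z)%MS.
Proof.
apply: (iffP submxP) => [[X ->] i j jZ | HM].
  by rewrite coordspE (negbTE jZ) mulr0.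
exists M; apply/matrixP=> i j; rewrite coordspE.
by case: (boolP (j \in Z)) => [|/HM ->]; rewrite ?mulr1 ?mul0r.
Qed.

Lemma leq_rank_coordsp (b : nat) (Z : {set 'I_b}) : (#|Z| <= \rank (coordsp Z))%N.
Proof.
pose E : 'M[K]_(#|Z|, b) := \matrix_(i, j) (j == enum_val i)%:R.
have EZ : (E <= coordsp Z)%MS.
  apply/sub_coordspP => i j jZ; rewrite mxE; case: eqP jZ => // ->.
  by rewrite enum_valP.
suff /eqP <- : row_free E by exact: mxrankS.
apply/row_freeP; exists E^T; apply/matrixP=> i j.
rewrite !mxE (bigD1 (enum_val i)) //= !mxE eqxx mul1r (inj_eq enum_val_inj) big1 ?addr0 //.
by move=> l ne; rewrite !mxE (negbTE ne) mul0r.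
Qed.

(** Z is a set of pivot columns for A: reading off the coordinates in Z is an isomorphism on A. *)
Definition transverse (m b : nat) (A : 'M[K]_(m, b)) (Z : {set 'I_b}) : Prop :=
  \rank A = #|Z| /\ (A :&: coordsp (~: Z) = 0)%MS.

Definition pivmask (m b : nat) (Z : {set 'I_b}) (g : {ffun 'I_m -> 'I_b}) :
  pred ('I_m * 'I_b) := fun s => s.2 \notin Z :|: [set g i | i in 'I_m].

(** Echelon form relative to Z: for injective g with values off Z, the columns in Z vanish, the
    columns g i form an identity matrix, and the others are free. *)
Definition pivmx (m b : nat) (Z : {set 'I_b}) (g : {ffun 'I_m -> 'I_b})
    (y : {s | pivmask Z g s} -> K) : 'M[K]_(m, b) :=
  maskmx (\matrix_(i, j) (j == g i)%:R) y.

Lemma transverse0 (b : nat) : transverse (0 : 'M[K]_b) set0.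
Proof. by split; rewrite ?mxrank0 ?cards0 ?cap0mx. Qed.

(** The intersection of U with the coordinate subspace of the complement of Z is a complement of A
    in U, and normalizing it on an invertible minor gives the chart. The enlarged pivot set is again
    transverse to U, so that chains can be charted one step at a time. *)
Lemma pivot_chart (m m1 m2 b : nat) (A : 'M[K]_(m1, b)) (U : 'M[K]_(m2, b))
    (Z : {set 'I_b}) :
  transverse A Z -> (A <= U)%MS -> \rank U = (\rank A + m)%N ->
  exists g : {ffun 'I_m -> 'I_b}, exists y : {s | pivmask Z g s} -> K,
    [/\ injective g, [disjoint Z & [set g i | i in 'I_m]],
        (U :=: A + pivmx y)%MS
      & transverse U (Z :|: [set g i | i in 'I_m])].
Proof.
move=> [rA capA] AU rU.
pose W := (U :&: coordsp (~: Z))%MS.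
have capAW : (A :&: W = 0)%MS.
  by apply/eqP; rewrite -submx0 -capA capmxS // capmxSr.
have AWU : (A + W <= U)%MS by rewrite addsmx_sub AU capmxSl.
have rAW := mxrank_disjoint_sum capAW.
(* The dimension formula gives rank at least m, and [capAW] gives at most m. *)
have rW : \rank W = m.
  have := mxrankS AWU; have := mxrank_sum_cap U (coordsp (~: Z)).
  have := leq_rank_coordsp (~: Z); have := rank_leq_col (U + coordsp (~: Z))%MS.
  have := cardsC Z; rewrite card_ord -/W; lia.
have UAW : (U :=: A + W)%MS.
  by apply/eqmx_sym/eqmxP; rewrite -(eq_leqif (mxrank_leqif_eq AWU)); lia.
pose W0 : 'M[K]_(m, b) := castmx (rW, erefl b) (row_base W).
have W0W : (W0 :=: W)%MS := eqmx_trans (eqmx_cast _ _) (eq_row_base W).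
have W0free : row_free W0 by rewrite /row_free W0W rW.
have [g g_inj Hu] := full_minor W0free.
pose Xi := invmx (colsub g W0) *m W0.
have XiW : (Xi :=: W)%MS by apply: eqmx_trans W0W; apply: eqmxMfull; rewrite row_full_unit unitmx_inv.
have Xig i l : Xi i (g l) = (i == l)%:R.
  have : colsub g Xi = 1%:M by rewrite -mulmx_colsub mulVmx.
  by move/matrixP/(_ i l); rewrite !mxE.
have XiZ i j : j \in Z -> Xi i j = 0.
  have /sub_coordspP H : (Xi <= coordsp (~: Z))%MS by rewrite XiW capmxSr.
  by move=> jZ; apply: H; rewrite inE jZ.
have dis : [disjoint Z & [set g i | i in 'I_m]].
  rewrite disjoints_subset; apply/subsetP=> j jZ; rewrite inE.
  apply/imsetP=> -[i _ E]; have := XiZ i j jZ; rewrite E (Xig i i) eqxx => /eqP.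
  by rewrite oner_eq0.
have [|y Hy] := @maskmx_surj K m b (pivmask Z g) (\matrix_(i, j) (j == g i)%:R) Xi.
  move=> i j; rewrite /pivmask negbK inE [RHS]mxE /=.
  case/orP=> [jZ|/imsetP[l _ ->]]; last by rewrite (Xig i l) (inj_eq g_inj) eq_sym.
  rewrite XiZ //; case: eqP => // E; move/pred0P/(_ j): dis => /=.
  by rewrite jZ E imset_f.
exists g, y; split=> //.
  rewrite /pivmx -Hy; apply: eqmx_trans UAW _.
  by apply: adds_eqmx => //; apply: eqmx_sym.
split.
  rewrite rU rA cardsU card_imset // card_ord.
  by move: dis; rewrite -setI_eq0 => /eqP ->; rewrite cards0 subn0.
(* Let v in U vanish on all pivots. Its component in W vanishes on Z, hence so does its component in
   A, which is therefore 0; what remains is a combination of rows of [Xi] whose coefficients are the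
   entries of v at the new pivots. *)
apply/eqP; rewrite -submx0; apply/rV_subP=> v.
rewrite sub_capmx => /andP[]; rewrite UAW => /sub_addsmxP[[u1 u2] /= Ev].
move/sub_coordspP => Hv.
have u2W : (u2 *m W <= coordsp (~: Z))%MS by apply: submx_trans (submxMl _ _) (capmxSr _ _).
have u1A : u1 *m A = 0.
  apply/eqP; rewrite -submx0 -capA sub_capmx submxMl /=.
  apply/sub_coordspP => i j; rewrite inE negbK => jZ.
  have := Hv i j; rewrite inE inE jZ => /(_ isT); rewrite Ev mxE.
  by move/sub_coordspP: u2W => ->; rewrite ?inE ?jZ ?addr0.
have /submxP[w Ew] : (v <= Xi)%MS by rewrite XiW Ev u1A add0r submxMl.
suff w0 : w = 0 by rewrite Ew w0 mul0mx sub0mx.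
apply/rowP=> l; have := Hv 0 (g l); rewrite inE inE imset_f ?orbT // => /(_ isT).
rewrite Ew mxE (bigD1 l) //= Xig eqxx mulr1 big1 ?addr0 => [->|i ne].
  by rewrite mxE.
by rewrite Xig (negbTE ne) mulr0.
Qed.

Lemma card_pivmask (m b : nat) (Z : {set 'I_b}) (g : {ffun 'I_m -> 'I_b}) :
  injective g -> [disjoint Z & [set g i | i in 'I_m]] ->
  #|{: {s | pivmask Z g s}}| = (m * (b - (#|Z| + m)))%N.
Proof.
move=> g_inj dis; rewrite card_sig.
have -> : #|[pred s | pivmask Z g s]| =
    #|setX [set: 'I_m] (~: (Z :|: [set g i | i in 'I_m]))|.
  by apply: eq_card => -[i j]; rewrite !inE /= /pivmask /= !inE.
rewrite cardsX cardsT card_ord; congr (_ * _)%N.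
rewrite cardsCs setCK card_ord cardsU card_imset // card_ord.
by move: dis; rewrite -setI_eq0 => /eqP ->; rewrite cards0 subn0.
Qed.

End Charts.

(** * Flags in a given Schubert position to a subspace *)

Section FlagCells.
Variables (R : realType) (n k : nat).
Local Notation C := R[i].
Implicit Types (D : {set 'I_n}) (F : 'M[C]_n) (W : 'M[C]_(k, n)).

Definition below D (j : nat) : nat := #|[set l in D | (l < j)%N]|.

Lemma flagspE F j : flagsp F j = (pid_mx j : 'M_n) *m F.
Proof.
apply/matrixP=> a b; rewrite !mxE (bigD1 a) //= !mxE eqxx /=.
rewrite big1 => [|l ne]; last by rewrite mxE (inj_eq val_inj) eq_sym (negbTE ne) mul0r.
by case: (a < j)%N; rewrite ?mul1r ?mul0r addr0.
Qed.

Lemma rank_flagsp F j : F \in unitmx -> (j <= n)%N -> \rank (flagsp F j) = j.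
Proof.
by move=> uF jn; rewrite flagspE mxrankMfree ?row_free_unit // rank_pid_mx.
Qed.

Lemma row_flagsp F i l : row i (flagsp F l) = if (i < l)%N then row i F else 0.
Proof. by apply/rowP=> b; rewrite !mxE; case: ifP => _; rewrite mxE. Qed.

Lemma flagsp0 F : flagsp F 0 = 0.
Proof. by apply/matrixP=> a b; rewrite !mxE. Qed.

Lemma flagspSr F (j : 'I_n) : (flagsp F j.+1 :=: flagsp F j + row j F)%MS.
Proof.
apply/eqmxP/andP; split.
  apply/row_subP=> i; rewrite row_flagsp ltnS leq_eqVlt; case: eqP => [/val_inj ->|_] /=.
    exact: addsmxSr.
  case: ifP => ij; last exact: sub0mx.
  by apply: submx_trans (addsmxSl _ _); have := row_sub i (flagsp F j); rewrite row_flagsp ij.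
rewrite addsmx_sub; apply/andP; split.
  apply/row_subP=> i; rewrite row_flagsp; case: ifP => ij; last exact: sub0mx.
  by have := row_sub i (flagsp F j.+1); rewrite row_flagsp ltnS (ltnW ij).
by have := row_sub j (flagsp F j.+1); rewrite row_flagsp ltnSn.
Qed.

Lemma flagspS F i j : (i <= j)%N -> (flagsp F i <= flagsp F j)%MS.
Proof.
move=> ij; apply/row_subP=> a.
rewrite row_flagsp; case: ifP => ai; last exact: sub0mx.
by have := row_sub a (flagsp F j); rewrite row_flagsp (leq_trans ai ij).
Qed.

(** The Schubert position of V: for invertible F these are the j at which the intersection of V with
    the flag grows on passing from [flagsp F j] to [flagsp F j.+1]. In this form a jump row is
    visibly a combination of V and earlier rows. *)
Definition jumps m (V : 'M[C]_(m, n)) F : {set 'I_n} :=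
  [set j : 'I_n | (row j F <= V + flagsp F j)%MS].

Lemma belowS D (j : 'I_n) : below D j.+1 = (below D j + (j \in D))%N.
Proof.
rewrite /below; case: (boolP (j \in D)) => jD.
  rewrite (cardsD1 j) !inE jD ltnSn addnC /=; congr (_ + _)%N; apply: eq_card => l.
  by rewrite !inE ltnS leq_eqVlt -val_eqE /=; case: (l \in D); case: ltngtP.
rewrite addn0; apply: eq_card => l; rewrite !inE ltnS leq_eqVlt.
by case: eqP => [/val_inj ->|//]; rewrite (negbTE jD).
Qed.

Lemma below0 D : below D 0 = 0%N.
Proof. by apply: eq_card0 => l; rewrite !inE ltn0 andbF. Qed.

Lemma below_compl D j : (j <= n)%N -> (below D j + below (~: D) j = j)%N.
Proof.
elim: j => [|j IH] jn; first by rewrite !below0.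
rewrite -[j]/(Ordinal jn : nat) !belowS /= inE; have := IH (ltnW jn).
by case: (_ \in D) => /=; lia.
Qed.

Lemma below_max D : below D n = #|D|.
Proof. by apply: eq_card => l; rewrite !inE ltn_ord andbT. Qed.

Lemma rank_add_flagsp m (V : 'M[C]_(m, n)) F j : (j <= n)%N ->
  \rank (V + flagsp F j)%MS = (\rank V + below (~: jumps V F) j)%N.
Proof.
elim: j => [|j IH] jn.
  rewrite flagsp0.
  by rewrite below0 addn0 addsmx0.
have {}IH := IH (ltnW jn); rewrite -[j]/(Ordinal jn : nat) in IH *.
set o := Ordinal jn in IH *; rewrite belowS addnA -IH.
have E : (V + flagsp F o.+1 :=: (V + flagsp F o) + row o F)%MS.
  by rewrite -addsmxA; apply: adds_eqmx => //; apply: flagspSr.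
rewrite E inE inE; case: (boolP (row o F <= V + flagsp F o)%MS) => ro.
  by rewrite addn0 (addsmx_idPl ro).
have c0 : (row o F :&: (V + flagsp F o) = 0)%MS.
  apply/eqP; rewrite -mxrank_eq0; have := rank_leq_row (row o F).
  have := mxrank_leqif_sup (capmxSl (row o F) (V + flagsp F o)%MS) => -[le eq].
  move: eq; rewrite sub_capmx submx_refl (negbTE ro) /= => /negbT.
  by move: le => /=; lia.
rewrite addsmxC mxrank_disjoint_sum // rank_rV addnC.
by have -> : row o F != 0 by apply: contraNneq ro => ->; rewrite sub0mx.
Qed.

Lemma rank_cap_flagsp m (V : 'M[C]_(m, n)) F j : F \in unitmx -> (j <= n)%N ->
  \rank (V :&: flagsp F j)%MS = below (jumps V F) j.
Proof.
move=> uF jn; have := mxrank_sum_cap V (flagsp F j).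
rewrite rank_add_flagsp // rank_flagsp //; have := below_compl (jumps V F) jn.
move: (\rank _) => x; lia.
Qed.

Lemma card_jumps m (V : 'M[C]_(m, n)) F : F \in unitmx -> #|jumps V F| = \rank V.
Proof.
move=> uF; rewrite -below_max -rank_cap_flagsp //.
have VF : (V <= flagsp F n)%MS by rewrite submx_full // /row_full rank_flagsp.
by rewrite (capmx_idPl VF).
Qed.

Definition nonjumprows D F j : 'M[C]_n :=
  \matrix_(a, b) (if (a < j)%N && (a \notin D) then F a b else 0).

Lemma flagsp_sub_nonjump m (V : 'M[C]_(m, n)) F j : (j <= n)%N ->
  (V + flagsp F j <= V + nonjumprows (jumps V F) F j)%MS.
Proof.
pose D := jumps V F; rewrite -/D.
have rowE i l : row i (nonjumprows D F l) = if (i < l)%N && (i \notin D) then row i F else 0.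
  by apply/rowP=> b; rewrite !mxE; case: ifP => _; rewrite mxE.
have mono i l : (i <= l)%N -> (nonjumprows D F i <= nonjumprows D F l)%MS.
  move=> il; apply/row_subP=> a; rewrite rowE; case: ifP => [/andP[ai aD]|_]; last exact: sub0mx.
  by have := row_sub a (nonjumprows D F l); rewrite rowE aD (leq_trans ai il).
elim: j => [|j IH] jn.
  rewrite flagsp0.
  by rewrite addsmx0 addsmxSl.
have {}IH := submx_trans (IH (ltnW jn)) (addsmxS (submx_refl V) (mono _ _ (leqnSn j))).
rewrite addsmx_sub addsmxSl -[j.+1]/(Ordinal jn).+1 flagspSr addsmx_sub.
rewrite (submx_trans (addsmxSr _ _) IH) /=.
case: (boolP (Ordinal jn \in D)) => jD.
  by apply: submx_trans IH; move: jD; rewrite inE.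
apply: submx_trans (addsmxSr _ _); have := row_sub (Ordinal jn) (nonjumprows D F j.+1).
by rewrite rowE jD /= ltnSn.
Qed.

(** The left n columns hold the rows outside D themselves and, for a row in D, its coefficients on
    earlier rows outside D; the right k columns hold the coefficients on W. *)
Definition flagmask D : pred ('I_n * 'I_(n + k)) := fun s =>
  match split s.2 with
  | inl l => (s.1 \notin D) || ((l \notin D) && (l < s.1)%N)
  | inr _ => s.1 \in D
  end.

(* A row of F outside D is free; a row in D is a combination of the earlier
   rows outside D and of the rows of W. *)
Definition flagmap D W (y : {s | flagmask D s} -> C) : 'M[C]_n :=
  let T := maskmx (0 : 'M[C]_(n, n + k)) y in
  let X := coordsp _ (~: D) *m lsubmx T in
  X + coordsp _ D *m lsubmx T *m X + rsubmx T *m W.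

Lemma flag_chart W F : exists y, F = @flagmap (jumps W F) W y.
Proof.
set D := jumps W F.
have Hj (j : 'I_n) : exists uc : 'rV[C]_k * 'rV[C]_n, (j \in D) ->
    row j F = uc.1 *m W + uc.2 *m nonjumprows D F j.
  case: (boolP (j \in D)) => jD; last by exists (0, 0).
  move: (jD); rewrite inE => jW.
  have := submx_trans jW (flagsp_sub_nonjump W F (ltnW (ltn_ord j))).
  by case/sub_addsmxP => uc E; exists uc.
have [uc Huc] := fin_all_exists Hj.
pose T : 'M[C]_(n, n + k) := row_mx
  (\matrix_(j, l) (if j \in D then (if (l \notin D) && (l < j)%N then (uc j).2 0 l else 0)
                   else F j l))
  (\matrix_(j, s) (if j \in D then (uc j).1 0 s else 0)).
have [|y Ey] := @maskmx_surj _ n (n + k) (flagmask D) 0 T.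
  move=> i c; rewrite /flagmask /T [RHS]mxE /=; case: split_ordP => l ->.
    by rewrite row_mxEl mxE; case: (i \in D) => //=; case: ifP.
  by rewrite row_mxEr mxE => /negbTE ->.
exists y; rewrite /flagmap -Ey row_mxKl row_mxKr; apply/row_matrixP=> j.
have diagE (E : {set 'I_n}) (M : 'M[C]_n) a b :
    (coordsp _ E *m M) a b = (a \in E)%:R * M a b.
  by rewrite /coordsp mul_diag_mx !mxE.
have addE m1 (M N : 'M[C]_(m1, n)) a b : (M + N) a b = M a b + N a b by rewrite mxE.
have mulE m1 m2 (M : 'M[C]_(m1, m2)) (N : 'M[C]_(m2, n)) a b :
    (M *m N) a b = \sum_l M a l * N l b by rewrite mxE.
have rowE m1 (M : 'M[C]_(m1, n)) a b : (row a M) 0 b = M a b by rewrite mxE.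
case: (boolP (j \in D)) => jD; last first.
  apply/rowP=> b; rewrite -mulmxA !rowE !addE !diagE !mxE inE (negbTE jD) /= mul1r mul0r addr0.
  by rewrite big1 ?addr0 // => s _; rewrite mxE (negbTE jD) mul0r.
rewrite (Huc j jD); apply/rowP=> b; rewrite -mulmxA rowE !addE !diagE !mulE inE jD /=.
rewrite !mul0r !mul1r add0r addrC; congr (_ + _); apply: eq_bigr => l _.
  rewrite diagE !mxE jD in_setC; case: (l \in D); case: (l < j)%N => /=;
    rewrite ?mul0r ?mulr0 ?mul1r //.
by rewrite mxE jD.
Qed.

Lemma polymx_flagmap (I : finType) D (h : {s | flagmask D s} -> I)
    (W : (I -> C) -> 'M[C]_(k, n)) :
  polymx W -> polymx (fun x => flagmap (W x) (x \o h)).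
Proof.
move=> HW; have HT := polymx_mask (0 : 'M[C]_(n, n + k)) h.
have Hc m1 m2 (M : 'M[C]_(m1, m2)) : polymx (fun _ : I -> C => M).
  by move=> i j; apply: polyfun_const.
have Hl : polymx (fun x : I -> C => lsubmx (maskmx (0 : 'M[C]_(n, n + k)) (x \o h))).
  by move=> i j; apply: polyfun_ext (HT i (lshift k j)) => x; rewrite mxE.
have Hr : polymx (fun x : I -> C => rsubmx (maskmx (0 : 'M[C]_(n, n + k)) (x \o h))).
  by move=> i j; apply: polyfun_ext (HT i (rshift n j)) => x; rewrite mxE.
apply: polymxD; last exact: polymxM.
apply: polymxD; first exact: polymxM.
by apply: polymxM; apply: polymxM.
Qed.

(** The Schubert conditions read on the jump set; i counts from 0, hence the shifts by one. *)
Definition schubert_set (lam : seq nat) D : bool :=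
  (#|D| == k) && [forall i : 'I_k, (i < below D ((n - k) + i.+1 - part_at lam i.+1))%N].

Lemma inSchubert_jumps lam F (V : 'M[C]_n) m (W : 'M[C]_(m, n)) :
  F \in unitmx -> (k <= n)%N -> (V :=: W)%MS -> inSchubert k lam F V ->
  schubert_set lam (jumps W F).
Proof.
move=> uF kn VW [rV HV]; rewrite /schubert_set card_jumps // -VW rV eqxx /=.
apply/forallP=> i; have ik := ltn_ord i; have /HV := ik : (1 <= i.+1 <= k)%N.
have -> : jumps W F = jumps V F.
  by apply/setP=> j; rewrite !inE (adds_eqmx VW (eqmx_refl _)).
rewrite rank_cap_flagsp //; lia.
Qed.

End FlagCells.

(** * Codimension of the Schubert conditions *)

Section SchubertCount.
Variables (n k : nat).
Implicit Type D : {set 'I_n}.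

Lemma card_flagmask_sum D :
  #|{: {s | @flagmask n k D s}}| =
    ((n - #|D|) * n + \sum_(j in D) (below (~: D) j + k))%N.
Proof.
rewrite card_sig.
transitivity (\sum_(j < n) \sum_(c < n + k | @flagmask n k D (j, c)) 1)%N.
  by rewrite -sum1_card pair_big_dep /=; apply: eq_bigl => -[j c].
rewrite (bigID (mem D)) /= addnC; congr (_ + _)%N.
  transitivity (\sum_(j < n | j \notin D) n)%N; last first.
    rewrite sum_nat_const; congr (_ * _)%N.
    have := cardC D; rewrite card_ord => ED; apply/eqP.
    have Dn : (#|D| <= n)%N by rewrite -[X in (_ <= X)%N]ED leq_addr.
    by rewrite -(eqn_add2l #|D|) subnKC //; apply/eqP.
  apply: eq_bigr => j jD; rewrite big_mkcond big_split_ord /=.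
  rewrite [X in (_ + X)%N]big1 => [|s _]; last first.
    by rewrite /flagmask (unsplitK (inr s)) /= (negbTE jD).
  rewrite addn0 -[RHS](card_ord n) -sum1_card; apply: eq_bigr => l _.
  by rewrite /flagmask (unsplitK (inl l)) /= jD.
apply: eq_bigr => j jD; rewrite big_mkcond big_split_ord /=; congr (_ + _)%N.
  rewrite /below -sum1_card [RHS]big_mkcond /=; apply: eq_bigr => l _.
  by rewrite /flagmask (unsplitK (inl l)) /= jD !inE.
rewrite -[RHS](card_ord k) -sum1_card; apply: eq_bigr => s _.
by rewrite /flagmask (unsplitK (inr s)) /= jD.
Qed.

Lemma below_lt_card D (j : 'I_n) : j \in D -> (below D j < #|D|)%N.
Proof.
move=> jD; apply: proper_card; apply/properP; split.
  by apply/subsetP=> l; rewrite inE => /andP[].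
by exists j => //; rewrite inE ltnn andbF.
Qed.

Lemma leq_below D i j : (i <= j)%N -> (below D i <= below D j)%N.
Proof.
move=> ij; apply: subset_leq_card; apply/subsetP=> l; rewrite !inE.
by case/andP=> -> /= li; apply: leq_trans ij.
Qed.

(* j |-> below D j enumerates D increasingly. *)
Lemma sum_below (D : {set 'I_n}) (f : nat -> nat) :
  (\sum_(j in D) f (below D j) = \sum_(i < #|D|) f i)%N.
Proof.
have [c Ec] : exists c, #|D| = c by exists #|D|.
rewrite Ec; case: c Ec => [|c] Ec.
  move/cards0_eq: Ec => ->; by rewrite big_set0 big_ord0.
pose h (j : 'I_n) : 'I_c.+1 := inord (below D j).
have hE j : j \in D -> h j = below D j :> nat.
  by move=> jD; rewrite inordK // -Ec below_lt_card.
have below_mono (j l : 'I_n) : j \in D -> (j < l)%N -> (below D j < below D l)%N.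
  move=> jD jl; apply: leq_trans (leq_below D jl).
  by rewrite belowS jD addn1.
have h_inj : {in D &, injective h}.
  move=> j l jD lD E; have {}E : below D j = below D l by rewrite -!hE // E.
  case: (ltngtP j l) => [jl|lj|/val_inj //].
    by have := below_mono _ _ jD jl; rewrite E ltnn.
  by have := below_mono _ _ lD lj; rewrite E ltnn.
transitivity (\sum_(j in D) f (h j))%N; first by apply: eq_bigr => j jD; rewrite hE.
rewrite -(big_imset (fun i : 'I_c.+1 => f i) h_inj) /=.
apply: eq_bigl => i; have -> : [set h j | j in D] = [set: 'I_c.+1]; last by rewrite inE.
by apply/eqP; rewrite eqEcard subsetT cardsT card_ord card_in_imset // Ec leqnn.
Qed.

(** If i elements of D precede j in D, the Schubert condition gives j <= n - k + i - lam_(i+1). So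
    at most n - k - lam_(i+1) earlier rows lie outside D, and row j has at most n - lam_(i+1)
    parameters instead of n. *)
Lemma card_flagmask lam D : (k <= n)%N -> is_part k (n - k) lam ->
  schubert_set k lam D ->
  (#|{: {s | @flagmask n k D s}}| + sumn lam <= n * n)%N.
Proof.
move=> kn [sl [_ /allP lamr]] /andP[/eqP cD /forallP HD].
rewrite card_flagmask_sum cD -addnA.
suff: (\sum_(j in D) (below (~: D) j + k) + sumn lam <= k * n)%N.
  have : ((n - k) * n + k * n = n * n)%N by rewrite -mulnDl subnK.
  lia.
have -> : sumn lam = (\sum_(j in D) nth 0%N lam (below D j))%N.
  by rewrite sum_below cD sumnE (big_nth 0%N) big_mkord sl.
rewrite -big_split /= -cD -sum_nat_const; apply: leq_sum => j jD.
have lt := below_lt_card jD; rewrite cD in lt.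
have := HD (Ordinal lt); rewrite /part_at /=.
have : (nth 0%N lam (below D j) <= n - k)%N by apply: lamr; rewrite mem_nth // sl.
set i := below D j; set a := nth _ _ _ => ar Hi.
(* Otherwise at most i elements of D would lie below the bound in [Hi]. *)
have : (j < (n - k) + i.+1 - a)%N.
  by rewrite ltnNge; apply/negP => /(leq_below D); rewrite -/i; lia.
have := below_compl D (ltnW (ltn_ord j)); rewrite -/i cD.
move: ar {Hi}; rewrite {}/a; move: (nth _ _ _) (below (~: D) j) (nat_of_ord j) => a q j'.
by move: {lt} i => i; clear -kn; lia.
Qed.

End SchubertCount.

(** * Parameter count for configurations *)

Section Configurations.
Variables (R : realType) (n k : nat).
Local Notation C := R[i].

(** The excess e measures how far V1 and V2 meet beyond A: for e = 0 the space A' is A, and e = 1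
    expresses that V1 and V2 share more than A. *)
Definition config (a e b : nat) (lam mu nu : seq nat) (F G H : 'M[C]_n) : Prop :=
  [/\ F \in unitmx, G \in unitmx & H \in unitmx] /\
  exists A A' B V1 V2 V3 : 'M[C]_n,
    [/\ \rank A = a, \rank A' = (a + e)%N & \rank B = b] /\
    [/\ (A <= A')%MS, (A' <= V1)%MS, (A' <= V2)%MS & (A <= V3)%MS] /\
    [/\ (V1 <= B)%MS, (V2 <= B)%MS & (V3 <= B)%MS] /\
    [/\ inSchubert k lam F V1, inSchubert k mu G V2 & inSchubert k nu H V3].

Definition pivset (m b : nat) (Z : {set 'I_b}) (g : {ffun 'I_m -> 'I_b}) : {set 'I_b} :=
  Z :|: [set g i | i in 'I_m].

Definition pivotal (m b : nat) (Z : {set 'I_b}) (g : {ffun 'I_m -> 'I_b}) : bool :=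
  injectiveb g && [disjoint Z & [set g i | i in 'I_m]].

Lemma card_pivset (m b : nat) (Z : {set 'I_b}) (g : {ffun 'I_m -> 'I_b}) :
  pivotal Z g -> #|pivset Z g| = (#|Z| + m)%N.
Proof.
case/andP=> /injectiveP g_inj dis; rewrite /pivset cardsU card_imset // card_ord.
by move: dis; rewrite -setI_eq0 => /eqP ->; rewrite cards0 subn0.
Qed.

(** The row number k' of the basis W is kept apart from k because the charts produce it as a sum
    such as a + (e + m). *)
Lemma inSchubert_chart lam (F V : 'M[C]_n) (k' : nat) (W : 'M[C]_(k', n)) :
  F \in unitmx -> (k <= n)%N -> k' = k -> (V :=: W)%MS -> inSchubert k lam F V ->
  exists D, schubert_set k lam D /\ exists y, F = @flagmap R n k' D W y.
Proof.
move=> uF kn Ek VW HV; exists (jumps W F); split.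
  exact: inSchubert_jumps HV.
exact: flag_chart.
Qed.

Variables (a e m m3 b : nat) (lam mu nu : seq nat).
Hypotheses (Hk1 : (a + (e + m) = k)%N) (Hk3 : (a + m3 = k)%N).
Hypotheses (kb : (k <= b)%N) (bn : (b <= n)%N).
Hypotheses (Hlam : is_part k (n - k) lam) (Hmu : is_part k (n - k) mu).
Hypothesis (Hnu : is_part k (n - k) nu).
Hypothesis Hnum :
  (b * (n - b) + a * (b - a) + e * (b - (a + e)) + m * (b - k) + m * (b - k)
     + m3 * (b - k) < sumn lam + sumn mu + sumn nu)%N.

(** The left side of [Hnum] counts the parameters of B in E, A in B, A' over A, V1 and V2 over A',
    and V3 over A. By [card_flagmask] the flags add at most 3 n^2 - |lam| - |mu| - |nu|, so the
    total is below 3 n^2. *)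
Lemma config_thin s : thin s (config a e b lam mu nu).
Proof.
have kn : (k <= n)%N by apply: leq_trans kb bn.
(* The discrete data are the pivots of six charts and three jump sets; for each choice the flags are
   polynomial in one point [x] of affine space. *)
pose S := fun F G H =>
  exists (g0 : {ffun 'I_b -> 'I_n}) (g1 : {ffun 'I_a -> 'I_b}) (g2 : {ffun 'I_e -> 'I_b})
    (g3 g4 : {ffun 'I_m -> 'I_b}) (g5 : {ffun 'I_m3 -> 'I_b}) (D1 D2 D3 : {set 'I_n}),
  let Z1 := pivset set0 g1 in let Z2 := pivset Z1 g2 in
  [&& pivotal set0 g0, pivotal set0 g1, pivotal Z1 g2, pivotal Z2 g3 & pivotal Z2 g4] &&
  [&& pivotal Z1 g5, schubert_set k lam D1, schubert_set k mu D2 & schubert_set k nu D3] /\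
  exists x : {s | pivmask set0 g0 s} + ({s | pivmask set0 g1 s} + ({s | pivmask Z1 g2 s} +
     ({s | pivmask Z2 g3 s} + ({s | pivmask Z2 g4 s} + ({s | pivmask Z1 g5 s} +
     ({s | @flagmask n (a + (e + m)) D1 s} + ({s | @flagmask n (a + (e + m)) D2 s} +
       {s | @flagmask n (a + m3) D3 s}))))))) -> C,
    let beta := pivmx (x \o inl) in
    let alpha := pivmx (x \o inr \o inl) in
    let gamma := pivmx (x \o inr \o inr \o inl) in
    let xi1 := pivmx (x \o inr \o inr \o inr \o inl) in
    let xi2 := pivmx (x \o inr \o inr \o inr \o inr \o inl) in
    let xi3 := pivmx (x \o inr \o inr \o inr \o inr \o inr \o inl) in
    [/\ F = flagmap (col_mx alpha (col_mx gamma xi1) *m beta)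
              (x \o inr \o inr \o inr \o inr \o inr \o inr \o inl),
        G = flagmap (col_mx alpha (col_mx gamma xi2) *m beta)
              (x \o inr \o inr \o inr \o inr \o inr \o inr \o inr \o inl)
      & H = flagmap (col_mx alpha xi3 *m beta)
              (x \o inr \o inr \o inr \o inr \o inr \o inr \o inr \o inr)].
apply: (@thin_sub R n s _ S); last first.
  apply: thin_exists => g0; apply: thin_exists => g1; apply: thin_exists => g2.
  apply: thin_exists => g3; apply: thin_exists => g4; apply: thin_exists => g5.
  apply: thin_exists => D1; apply: thin_exists => D2; apply: thin_exists => D3.
  apply: thin_guard => /andP[/and5P[P0 P1 P2 P3 P4] /and4P[P5 Q1 Q2 Q3]].
  have cP m' b' Z (g : {ffun 'I_m' -> 'I_b'}) : pivotal Z g ->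
      #|{: {s | pivmask Z g s}}| = (m' * (b' - (#|Z| + m')))%N.
    by case/andP=> /injectiveP gi gd; rewrite card_pivmask.
  have cZ1 := card_pivset P1; rewrite cards0 in cZ1.
  have cZ2 := card_pivset P2; rewrite cZ1 in cZ2.
  apply: thin_image.
  - rewrite !card_sum !cP // cZ1 cZ2 !cards0.
    have cF k' D lam' : k' = k -> is_part k (n - k) lam' -> schubert_set k lam' D ->
        (#|{: {s | @flagmask n k' D s}}| + sumn lam' <= n * n)%N.
      by move=> ->; apply: card_flagmask.
    have -> : (0 + a + e + m = k)%N by lia.
    have -> : (0 + a + m3 = k)%N by lia.
    have num (x0 x1 x2 x3 x4 x5 c1 c2 c3 l1 l2 l3 N : nat) :
        (x0 + x1 + x2 + x3 + x4 + x5 < l1 + l2 + l3)%N ->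
        (c1 + l1 <= N)%N -> (c2 + l2 <= N)%N -> (c3 + l3 <= N)%N ->
        (x0 + (x1 + (x2 + (x3 + (x4 + (x5 + (c1 + (c2 + c3))))))) < N + N + N)%N by lia.
    rewrite !add0n; apply: (num _ _ _ _ _ _ _ _ _ _ _ _ _ Hnum); exact: cF.
  - apply: polymx_flagmap; apply: polymxM; last exact: polymx_mask.
    apply: polymx_col; first exact: (polymx_mask _ (fun s => inr (inl s))).
    apply: polymx_col; first exact: (polymx_mask _ (fun s => inr (inr (inl s)))).
    exact: (polymx_mask _ (fun s => inr (inr (inr (inl s))))).
  - apply: polymx_flagmap; apply: polymxM; last exact: polymx_mask.
    apply: polymx_col; first exact: (polymx_mask _ (fun s => inr (inl s))).
    apply: polymx_col; first exact: (polymx_mask _ (fun s => inr (inr (inl s)))).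
    exact: (polymx_mask _ (fun s => inr (inr (inr (inr (inl s)))))).
  - apply: polymx_flagmap; apply: polymxM; last exact: polymx_mask.
    apply: polymx_col; first exact: (polymx_mask _ (fun s => inr (inl s))).
    exact: (polymx_mask _ (fun s => inr (inr (inr (inr (inr (inl s))))))).
move=> F G H [[uF uG uH] [A [A' [B [V1 [V2 [V3 [[rA rA' rB]
  [[AA' AV1 AV2 AV3] [[VB1 VB2 VB3] [S1 S2 S3]]]]]]]]]]].
have [g0 [y0 [i0 d0 E0 _]]] := pivot_chart (m := b) (transverse0 C n) (sub0mx _ B)
  (etrans rB (esym (congr1 (addn^~ b) (mxrank0 C n n)))).
set beta := pivmx y0 in E0.
have {}E0 : (B :=: beta)%MS by apply: eqmx_trans E0 (adds0mx _ _).
have fbeta : row_free beta by rewrite /row_free -E0 rB.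
(* Coordinates with respect to the basis [beta] of B: the spaces inside B are charted in dimension
   b. *)
pose crd (M : 'M[C]_n) := M *m pinvmx beta.
have crdK M : (M <= B)%MS -> crd M *m beta = M.
  by rewrite E0 => MB; rewrite /crd mulmxKpV.
have rcrd M : (M <= B)%MS -> \rank (crd M) = \rank M.
  by move=> MB; rewrite -[in RHS](crdK M MB); exact: (esym (mxrankMfree _ fbeta)).
have scrd M N : (M <= N)%MS -> (crd M <= crd N)%MS by apply: submxMr.
have A'B := submx_trans AV1 VB1; have AB := submx_trans AA' A'B.
have rS (V : 'M[C]_n) (lam' : seq nat) F' : inSchubert k lam' F' V -> \rank V = k by case.
have rA0 : \rank (crd A) = (\rank (0%R : 'M[C]_b) + a)%N by rewrite rcrd // rA mxrank0.
have [g1 [y1 [i1 d1 E1 T1]]] := pivot_chart (transverse0 C b) (sub0mx _ (crd A)) rA0.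
have [g2 [y2 [i2 d2 E2 T2]]] := pivot_chart (m := e) T1 (scrd _ _ AA')
  (etrans (rcrd _ A'B) (etrans rA' (esym (congr1 (addn^~ e) (etrans (rcrd _ AB) rA))))).
have rV12 V lam' F' : (V <= B)%MS -> inSchubert k lam' F' V ->
    \rank (crd V) = (\rank (crd A') + m)%N.
  by move=> VB /rS rV; rewrite !rcrd // rV rA' -Hk1 addnA.
have [g3 [y3 [i3 d3 E3 _]]] := pivot_chart (m := m) T2 (scrd _ _ AV1) (rV12 _ _ _ VB1 S1).
have [g4 [y4 [i4 d4 E4 _]]] := pivot_chart (m := m) T2 (scrd _ _ AV2) (rV12 _ _ _ VB2 S2).
have rV3 : \rank (crd V3) = (\rank (crd A) + m3)%N.
  by rewrite !rcrd // (rS _ _ _ S3) rA -Hk3.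
have [g5 [y5 [i5 d5 E5 _]]] := pivot_chart (m := m3) T1 (scrd _ _ AV3) rV3.
have {}E1 : (crd A :=: pivmx y1)%MS by apply: eqmx_trans E1 (adds0mx _ _).
have W3 : (V3 :=: col_mx (pivmx y1) (pivmx y5) *m beta)%MS.
  rewrite -{1}(crdK _ VB3); apply: eqmxMr; apply: eqmx_trans E5 _.
  by apply: eqmx_trans (addsmxE _ _); apply: adds_eqmx.
have W12 V (g : {ffun 'I_m -> 'I_b})
      (y : {s | pivmask (pivset (pivset set0 g1) g2) g s} -> C) :
    (V <= B)%MS -> (crd V :=: crd A' + pivmx y)%MS ->
    (V :=: col_mx (pivmx y1) (col_mx (pivmx y2) (pivmx y)) *m beta)%MS.
  move=> VB EV; rewrite -{1}(crdK _ VB); apply: eqmxMr; apply: eqmx_trans EV _.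
  apply: eqmx_trans (addsmxE _ _).
  apply: eqmx_trans (_ : (_ :=: pivmx y1 + (pivmx y2 + pivmx y))%MS) _.
    by rewrite addsmxA; apply: adds_eqmx => //; apply: eqmx_trans E2 _; apply: adds_eqmx.
  by apply: adds_eqmx => //; apply: addsmxE.
have [D1 [Q1 [z1 F1]]] := inSchubert_chart uF kn Hk1 (W12 _ _ _ VB1 E3) S1.
have [D2 [Q2 [z2 F2]]] := inSchubert_chart uG kn Hk1 (W12 _ _ _ VB2 E4) S2.
have [D3 [Q3 [z3 F3]]] := inSchubert_chart uH kn Hk3 W3 S3.
exists g0, g1, g2, g3, g4, g5, D1, D2, D3; split.
  rewrite Q1 Q2 Q3 /pivotal d0 d1 d2 d3 d4 d5 !andbT.
  by do !(apply/andP; split); apply/injectiveP.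
pose glue (X Y : Type) (f : X -> C) (h : Y -> C) := fun s : X + Y =>
  match s with inl u => f u | inr v => h v end.
by exists (glue _ _ y0 (glue _ _ y1 (glue _ _ y2 (glue _ _ y3 (glue _ _ y4 (glue _ _ y5
  (glue _ _ z1 (glue _ _ z2 z3)))))))).
Qed.

End Configurations.

(** * Dimension inequalities and generic flags *)

Section GenericFlags.
Variables (R : realType) (n k d : nat) (lam mu nu : seq nat).
Local Notation C := R[i].
Hypotheses (k1 : (1 <= k)%N) (kn : (k < n)%N).
Hypotheses (Hlam : is_part k (n - k) lam) (Hmu : is_part k (n - k) mu).
Hypothesis (Hnu : is_part k (n - k) nu).
Hypothesis Hsum : (sumn lam + sumn mu + sumn nu = k * (n - k) + n * d)%N.

(* The dimension of the flag variety F(a, b; n) plus 3 (k - a) (b - k) falls short of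
   |lam| + |mu| + |nu|: with a = k - x and b = k + y the difference is
   (n - k) (d - y) + k (d - x) + (x - y)^2. *)
Lemma kerspan_dim_lt a b : (a <= k)%N -> (k <= b)%N -> (b <= n)%N ->
  (k <= a + d)%N -> (b <= k + d)%N -> ~~ ((a + d == k) && (b == k + d))%N ->
  (b * (n - b) + a * (b - a) + 0 * (b - (a + 0)) + (k - a) * (b - k) + (k - a) * (b - k)
     + (k - a) * (b - k) < k * (n - k) + n * d)%N.
Proof.
move=> ak kb bn kad bkd ne.
have [x Ek] : exists x, (k = a + x)%N by exists (k - a)%N; lia.
have [y Eb] : exists y, (b = k + y)%N by exists (b - k)%N; lia.
have [z En] : exists z, (n = b + z)%N by exists (n - b)%N; lia.
have [u Ex] : exists u, (d = x + u)%N by exists (d - x)%N; lia.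
have [v Ey] : exists v, (d = y + v)%N by exists (d - y)%N; lia.
have -> : (n - b = z)%N by lia.
have -> : (b - a = x + y)%N by lia.
have -> : (k - a = x)%N by lia.
have -> : (b - k = y)%N by lia.
have -> : (n - k = y + z)%N by lia.
have uv : (0 < u + v)%N by lia.
have r0 : (0 < y + z)%N by lia.
(* This is n d = k d + (n - k) d, with d written as x + u in the first term and as y + v in the
   second. *)
have Ed : ((b + z) * d = (a + x) * (x + u) + (y + z) * (y + v))%N.
  by rewrite -Ex -Ey Eb Ek -mulnDl !addnA.
have : (0 < (y + z) * v + (a + x) * u)%N.
  have a0 : (0 < a + x)%N by lia.
  by case: (posnP u) => u0; rewrite addn_gt0 !muln_gt0 ?r0 ?a0; lia.
(* The square (x - y)^2 is nonnegative, stated without subtraction. *)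
have : (x * y + x * y <= x * x + y * y)%N.
  by have [+ _] := nat_Cauchy x y; rewrite -!mulnn; lia.
rewrite En Ed Eb Ek mul0n; clear; nia.
Qed.

(** For e = 0 the two sides would be equal. For e = 1 the 2 d^2 parameters of V1 and V2 over A
    become (2 d - 1) + 2 (d - 1) d = 2 d^2 - 1, one less. *)
Lemma nontransverse_dim_lt : (0 < d)%N -> (d <= k)%N -> (k + d <= n)%N ->
  ((k + d) * (n - (k + d)) + (k - d) * (k + d - (k - d)) + 1 * (k + d - (k - d + 1))
     + (d - 1) * (k + d - k) + (d - 1) * (k + d - k) + d * (k + d - k)
   < k * (n - k) + n * d)%N.
Proof.
move=> d0 dk kdn.
have [c Ec] : exists c, d = c.+1 by exists d.-1; lia.
have [a Ek] : exists a, (k = a + d)%N by exists (k - d)%N; lia.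
have [z En] : exists z, (n = k + d + z)%N by exists (n - (k + d))%N; lia.
have -> : (n - (k + d) = z)%N by lia.
have -> : (k + d - (k - d) = d + d)%N by lia.
have -> : (k + d - (k - d + 1) = c + c.+1)%N by lia.
have -> : (d - 1 = c)%N by lia.
have -> : (k + d - k = d)%N by lia.
have -> : (n - k = d + z)%N by lia.
have -> : (k - d = a)%N by lia.
rewrite En Ek Ec; nia.
Qed.

(** P is a product of four equations: one for the finitely many nonextremal dimensions (a, b), and
    one for each pair of flags, listed first so that [config] with e = 1 speaks of that pair. *)
Lemma generic_flags : exists P : {mpoly C[n * n + n * n + n * n]},
  P != 0 /\ forall F G H : 'M[C]_n, P.@[flag_coords F G H] != 0 ->
  (forall a b, (a <= k)%N -> (k <= b)%N -> (b <= n)%N -> (k <= a + d)%N -> (b <= k + d)%N ->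
     config k a 0 b lam mu nu F G H -> (a + d = k)%N /\ b = (k + d)%N) /\
  ((0 < d)%N -> (d <= k)%N -> (k + d <= n)%N ->
     [/\ ~ config k (k - d) 1 (k + d) lam mu nu F G H,
         ~ config k (k - d) 1 (k + d) lam nu mu F H G
       & ~ config k (k - d) 1 (k + d) nu mu lam H G F]).
Proof.
pose bad0 := fun F G H : 'M[C]_n => exists a : 'I_n.+1, exists b : 'I_n.+1,
  [&& a <= k, k <= b, k <= a + d, b <= k + d & ~~ ((a + d == k) && (b == k + d :> nat))]%N
  /\ config k a 0 b lam mu nu F G H.
have [P0 [P00 HP0]] : thin 0 bad0.
  apply: thin_exists => a; apply: thin_exists => b; apply: thin_guard.
  case/and5P=> ak kb kad bkd ne; have bn : (b <= n)%N by rewrite -ltnS.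
  apply: (@config_thin R n k a 0 (k - a) (k - a)) => //; try lia.
  rewrite Hsum; exact: kerspan_dim_lt.
have Ht s l1 l2 l3 : is_part k (n - k) l1 -> is_part k (n - k) l2 -> is_part k (n - k) l3 ->
    (sumn l1 + sumn l2 + sumn l3 = k * (n - k) + n * d)%N ->
    thin s (fun F G H : 'M[C]_n => [&& 0 < d, d <= k & k + d <= n]%N /\
      config k (k - d) 1 (k + d) l1 l2 l3 F G H).
  move=> p1 p2 p3 Hs; apply: thin_guard => /and3P[d0 dk kdn].
  apply: (@config_thin R n k (k - d) 1 (d - 1) d) => //; try lia.
  rewrite Hs; exact: nontransverse_dim_lt.
have [P1 [P10 HP1]] := Ht 0%N _ _ _ Hlam Hmu Hnu Hsum.
have [|P2 [P20 HP2]] := Ht 1%N _ _ _ Hlam Hnu Hmu; first by rewrite -Hsum addnAC.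
have [|P3 [P30 HP3]] := Ht 2 _ _ _ Hnu Hmu Hlam; first by rewrite -Hsum; lia.
exists (P0 * P1 * P2 * P3); split; first by rewrite !mulf_neq0.
move=> F G H; rewrite !mevalM !mulf_eq0 !negb_or => /andP[/andP[/andP[N0 N1] N2] N3].
split=> [a b ak kb bn kad bkd cf|d0 dk kdn].
  case: (boolP ((a + d == k) && (b == k + d :> nat))%N) => [/andP[/eqP -> /eqP ->] //|ne].
  have an : (a < n.+1)%N by lia.
  rewrite -ltnS in bn; case/eqP: N0; apply: (HP0 F G H).
  by exists (Ordinal an), (Ordinal bn); split=> //; apply/and5P; split.
have g : [&& 0 < d, d <= k & k + d <= n]%N by apply/and3P.
split=> cf.
- by case/eqP: N1; apply: (HP1 F G H).
- by case/eqP: N2; apply: (HP2 F H G).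
- by case/eqP: N3; apply: (HP3 H G F).
Qed.

End GenericFlags.

(** * Exchange of subspaces inside a Schubert variety *)

Section Pencils.
Variable (R : realType) (n : nat).
Local Notation C := R[i].

Lemma intermediate_subspace (K : fieldType) (m1 m2 b r : nat)
    (X : 'M[K]_(m1, b)) (Y : 'M[K]_(m2, b)) :
  (X <= Y)%MS -> (\rank X <= r <= \rank Y)%N ->
  exists Z : 'M[K]_b, [/\ (X <= Z)%MS, (Z <= Y)%MS & \rank Z = r].
Proof.
move=> XY /andP[Xr rY].
have rD : (\rank X + \rank (Y :\: X)%MS = \rank Y)%N.
  by rewrite -(mxrank_cap_compl Y X) (capmx_idPr XY).
pose L := (pid_mx (r - \rank X) : 'M_(\rank (Y :\: X)%MS)) *m row_base (Y :\: X)%MS.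
have LD : (L <= Y :\: X)%MS by rewrite -(eq_row_base (Y :\: X)%MS) submxMl.
exists (X + L)%MS; split; first exact: addsmxSl.
  by rewrite addsmx_sub XY (submx_trans LD (diffmxSl _ _)).
rewrite mxrank_disjoint_sum.
  by rewrite mxrankMfree ?row_base_free // rank_pid_mx; lia.
apply/eqP; rewrite -submx0 -(capmx_diff Y X) capmxC.
exact: capmxS LD (submx_refl _).
Qed.

(** By the modular law V = A + (Fj :&: V). Hence for A <= V <= A + Fj the dimension of V :&: Fj
    depends on V only through its rank. *)
Lemma rank_cap_modular m1 m2 m3 (A : 'M[C]_(m1, n)) (V : 'M[C]_(m2, n))
    (Fj : 'M[C]_(m3, n)) :
  (A <= V)%MS -> (V <= A + Fj)%MS ->
  (\rank (V :&: Fj) + \rank A = \rank V + \rank (A :&: Fj))%N.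
Proof.
move=> AV VAF.
have E : (V :=: A + (Fj :&: V))%MS.
  apply: eqmx_sym; apply: eqmx_trans (matrix_modl Fj AV) _.
  by apply/eqmxP; rewrite capmxSr sub_capmx VAF /=.
have := mxrank_sum_cap A (Fj :&: V)%MS; rewrite -E.
have -> : \rank (A :&: (Fj :&: V))%MS = \rank (A :&: Fj)%MS.
  apply/eqP; rewrite capmxA (capmx_idPl _) //.
  exact: submx_trans (capmxSl _ _) AV.
rewrite (capmxC Fj V); lia.
Qed.

(* The Schubert conditions on spaces between A and B refer to a flag of B / A.
   Swapping a vector of V of the last level against one of the same level keeps them. *)
Lemma schubert_pencil k d lam (F A B V V' V2 : 'M[C]_n) :
  F \in unitmx -> (d <= k)%N -> \rank A = (k - d)%N -> \rank B = (k + d)%N ->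
  (A <= V)%MS -> (V <= B)%MS -> (A <= V')%MS -> (V' <= B)%MS ->
  (A <= V2)%MS -> (V2 <= B)%MS -> \rank V2 = k ->
  inSchubert k lam F V -> inSchubert k lam F V' -> ~~ (V == V')%MS ->
  exists V'' : 'M[C]_n, [/\ inSchubert k lam F V'', (A <= V'')%MS, (V'' <= B)%MS
    & (\rank A < \rank (V'' :&: V2)%MS)%N].
Proof.
move=> uF dk rA rB AV VB AV' V'B AV2 V2B rV2 SV SV' neV.
have [rV HV] := SV; have [rV' HV'] := SV'.
have exm : exists j, (V + V' <= A + flagsp F j)%MS.
  exists n; apply: submx_trans (addsmxSr _ _).
  by rewrite submx_full // /row_full rank_flagsp.
(* The least level containing V + V' modulo A is p + 1; level 0 would force V and V' to equal A. *)
case: (ex_minnP exm) => -[|p] Hp minp.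
  move: Hp; rewrite flagsp0 addsmx0 addsmx_sub => /andP[VA V'A].
  by case/negP: neV; rewrite (submx_trans VA AV') (submx_trans V'A AV).
have {minp} : ~~ (V + V' <= A + flagsp F p)%MS.
  by apply/negP => /minp; rewrite ltnn.
wlog VnA : V V' AV VB AV' V'B SV SV' neV rV HV rV' HV' Hp {exm} /
    ~~ (V <= A + flagsp F p)%MS.
  move=> wl; rewrite addsmx_sub negb_and => /orP[VnA|V'nA].
    by apply: (wl V V') => //; rewrite addsmx_sub negb_and VnA.
  apply: (wl V' V) => //; first by rewrite andbC.
    by rewrite addsmx_sub andbC -addsmx_sub.
  by rewrite addsmx_sub negb_and V'nA.
move=> _; pose Q := (V :&: (A + flagsp F p))%MS; pose T := (V + V')%MS.
have QV : (\rank Q < k)%N.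
  rewrite -rV; have [le eq] := mxrank_leqif_sup (capmxSl V (A + flagsp F p)%MS).
  by rewrite ltn_neqAle le andbT eq sub_capmx submx_refl.
have AQ : (A <= Q)%MS by rewrite sub_capmx AV addsmxSl.
have TB : (T <= B)%MS by rewrite addsmx_sub VB.
have rT : (k < \rank T)%N.
  rewrite -{1}rV; have [le eq] := mxrank_leqif_sup (addsmxSl V V').
  rewrite ltn_neqAle le andbT eq addsmx_sub submx_refl /=.
  apply: contra neV => V'V; rewrite andbC V'V /=.
  by have [_ <-] := mxrank_leqif_sup V'V; rewrite rV rV'.
(* Inside B, of dimension k + d, spaces of dimension at least k + 1 and k meet in dimension at least
   k - d + 1. *)
have rTV2 : (\rank A < \rank (T :&: V2)%MS)%N.
  have := mxrank_sum_cap T V2; rewrite rV2 rA.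
  have : (\rank (T + V2)%MS <= k + d)%N by rewrite -rB mxrankS // addsmx_sub TB.
  move: rT dk; move: (\rank T) (\rank (T + V2)%MS) (\rank (T :&: V2)%MS).
  by clear => *; lia.
have [i wA] : exists i, ~~ (row i (T :&: V2)%MS <= A)%MS.
  by apply/row_subPn; apply/negP => /mxrankS; rewrite leqNgt rTV2.
set w := row i _ in wA.
have /andP[wT wV2] : (w <= T)%MS && (w <= V2)%MS by rewrite -sub_capmx row_sub.
(* Since Q has rank below k, there is room for the vector w of V2 outside A. *)
have [||V'' [QwV'' V''T rV'']] := @intermediate_subspace _ _ _ _ k (Q + w)%MS T.
- by rewrite addsmx_sub wT (submx_trans (capmxSl _ _) (addsmxSl _ _)).
- rewrite (ltnW rT) andbT; have := mxrank_adds_leqif Q w => -[le _].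
  apply: leq_trans le _; move: QV (rank_leq_row w).
  by move: (\rank Q) (\rank w); clear => *; lia.
move: QwV''; rewrite addsmx_sub => /andP[QV'' wV''].
have AV'' := submx_trans AQ QV''.
exists V''; split=> //; last first.
- have Aw : (A + w <= V'' :&: V2)%MS.
    by rewrite addsmx_sub !sub_capmx AV'' AV2 wV'' wV2.
  apply: leq_trans (mxrankS Aw).
  have [le eq] := mxrank_leqif_sup (addsmxSl A w).
  by rewrite ltn_neqAle le andbT eq addsmx_sub submx_refl.
- exact: submx_trans TB.
split=> // j /HV; set l := (_ + j - _)%N => Hj; apply: leq_trans Hj _.
(* Up to level p the intersection with V lies in Q, hence in V''; beyond p, [rank_cap_modular] gives
   V and V'' the same dimension. *)
case: (leqP l p) => lp.
  apply: mxrankS; rewrite sub_capmx capmxSr andbT; apply: submx_trans QV''.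
  by apply: capmxS => //; apply: submx_trans (flagspS F lp) (addsmxSr _ _).
have TAF : (T <= A + flagsp F l)%MS.
  by apply: submx_trans Hp _; apply: addsmxS => //; apply: flagspS.
have := rank_cap_modular AV (submx_trans (addsmxSl _ _) TAF).
have := rank_cap_modular AV'' (submx_trans V''T TAF).
rewrite rV rV''; move: (\rank (V'' :&: _)%MS) (\rank (V :&: _)%MS) (\rank (A :&: _)%MS).
by move: (\rank A); clear => *; lia.
Qed.

End Pencils.

(** * Row reduction of polynomial matrices *)

Section RowReduction.
Variable K : closedFieldType.

Lemma coefM_top (p q : {poly K}) a b : (size p <= a.+1)%N -> (size q <= b.+1)%N ->
  (p * q)`_(a + b) = p`_a * q`_b.
Proof.
move=> sp sq; rewrite coefM (bigD1 (inord a)) //= inordK ?ltnS ?leq_addr // addKn.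
rewrite big1 ?addr0 // => i; rewrite -val_eqE /= inordK ?ltnS ?leq_addr // => ne.
case: (ltngtP i a) ne => // ia _.
  by rewrite [q`__]nth_default ?mulr0 //; apply: leq_trans sq _; lia.
by rewrite nth_default ?mul0r // (leq_trans sp).
Qed.

Lemma coef_prod_top (k : nat) (p : 'I_k -> {poly K}) (delta : 'I_k -> nat) :
  (forall i, size (p i) <= (delta i).+1)%N ->
  (size (\prod_i p i)%R <= (\sum_i delta i).+1)%N /\
  (\prod_i p i)`_(\sum_i delta i)%N = \prod_i (p i)`_(delta i).
Proof.
move=> Hp; elim: (index_enum _) => [|i r [IH1 IH2]].
  by rewrite !big_nil size_poly1 coef1.
rewrite !big_cons; split; last by rewrite coefM_top // IH2.
by apply: leq_trans (size_polyMleq _ _) _; have := Hp i; lia.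
Qed.

(** [delta] only bounds the row degrees, so rows may vanish here; when the rows are independent, the
    polynomial matrix is row reduced. *)
Definition leadmx (k n : nat) (delta : 'I_k -> nat) (M : 'M[{poly K}]_(k, n)) : 'M[K]_(k, n) :=
  \matrix_(i, j) (M i j)`_(delta i).

Lemma coef_det_top (k : nat) (delta : 'I_k -> nat) (M : 'M[{poly K}]_k) :
  (forall i j, size (M i j) <= (delta i).+1)%N ->
  (size (\det M) <= (\sum_i delta i).+1)%N /\
  (\det M)`_(\sum_i delta i)%N = \det (leadmx delta M).
Proof.
move=> HM; have Hs (s : 'S_k) := coef_prod_top (p := fun i => M i (s i)) (fun i => HM i (s i)).
have sgn (s : 'S_k) (p : {poly K}) : (-1) ^+ s * p = (-1) ^+ s *: p.
  by case: (odd_perm s); rewrite ?expr1 ?expr0 ?scaleN1r ?mulN1r ?scale1r ?mul1r.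
split.
  apply/leq_sizeP => l Hl; rewrite /determinant coef_sum big1 // => s _.
  by rewrite sgn coefZ nth_default ?mulr0 //; apply: leq_trans (Hs s).1 _.
rewrite /determinant coef_sum; apply: eq_bigr => s _.
by rewrite sgn coefZ (Hs s).2; congr (_ * _); apply: eq_bigr => i _; rewrite mxE.
Qed.

Local Notation ev t := (map_mx (horner_eval t)).

(** Induction on the sum of the degree bounds. Given a relation c between leading rows, row i is
    replaced by the sum of c_b X^(delta i - delta b) times row b, which cancels its top
    coefficient. *)
Lemma row_reduce (k n : nat) (M : 'M[{poly K}]_(k, n)) (delta : 'I_k -> nat) :
  (forall t, \rank (ev t M) = k) ->
  (forall i j, size (M i j) <= (delta i).+1)%N ->
  exists (U : 'M[{poly K}]_k) (delta' : 'I_k -> nat),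
    [/\ forall t, \rank (ev t (U *m M)) = k,
        forall t, ev t U \in unitmx,
        forall i j, (size ((U *m M) i j) <= (delta' i).+1)%N
      & row_free (leadmx delta' (U *m M))].
Proof.
elim: {delta}_.+1 {-2}delta (ltnSn (\sum_i delta i)) M => // B IH delta ltB M rM sM.
set L := leadmx delta M.
case: (boolP (row_free L)) => [Lfree|].
  exists 1%:M, delta; rewrite mul1mx; split=> // t.
  by rewrite map_mx1 unitmx1.
rewrite -kermx_eq0 => /rowV0Pn[c /sub_kermxP cL /rV0Pn[i0 ci0]].
(* Maximality of [delta i] on the support of c makes the exponents honest differences; c_i != 0
   makes [U] invertible at every point. *)
case: (@arg_maxnP _ i0 (fun i => c 0 i != 0) delta ci0) => i ci maxi.
pose U : 'M[{poly K}]_k :=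
  \matrix_(a, b) if a == i then c 0 b *: 'X^(delta i - delta b) else (a == b)%:R.
have uU t : ev t U \in unitmx.
  rewrite -row_free_unit; apply: inj_row_free => v vU.
  have vi : v 0 i = 0.
    move/rowP/(_ i): vU; rewrite !mxE (bigD1 i) //= !mxE eqxx subnn expr0.
    rewrite /horner_eval hornerZ hornerC mulr1 big1 ?addr0 => [|a ne].
      by move/eqP; rewrite mulf_eq0 (negbTE ci) orbF => /eqP.
    by rewrite !mxE (negbTE ne) horner0 mulr0.
  apply/rowP=> b; rewrite [RHS]mxE; have [-> //|ne] := eqVneq b i.
  move/rowP/(_ b): vU; rewrite !mxE (bigD1 b) //= !mxE (negbTE ne) eqxx.
  rewrite /horner_eval hornerC mulr1 big1 ?addr0 // => a nab.
  rewrite !mxE; have [->|nai] := eqVneq a i; first by rewrite vi mul0r.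
  by rewrite (negbTE nab) horner0 mulr0.
have rUM t : \rank (ev t (U *m M)) = k.
  have fU : row_full (ev t U) by rewrite row_full_unit.
  by rewrite map_mxM (eqmxMfull (ev t M) fU) rM.
have UMi j : (U *m M) i j = \sum_b c 0 b *: ('X^(delta i - delta b) * M b j).
  by rewrite mxE; apply: eq_bigr => b _; rewrite mxE eqxx scalerAl.
have UMa a j : a != i -> (U *m M) a j = M a j.
  move=> ne; rewrite mxE (bigD1 a) //= mxE (negbTE ne) eqxx mul1r big1 ?addr0 //.
  by move=> b nb; rewrite mxE (negbTE ne) eq_sym (negbTE nb) mul0r.
have si j : (size ((U *m M) i j) <= delta i)%N.
  apply/leq_sizeP => l Hl; rewrite UMi coef_sum.
  move: Hl; rewrite leq_eqVlt => /predU1P[<-|Hl].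
    move/rowP/(_ j): cL; rewrite !mxE => cL; rewrite -[RHS]cL.
    apply: eq_bigr => b _; rewrite coefZ mxE.
    have [->|cb] := eqVneq (c 0 b) 0; first by rewrite !mul0r.
    have Hb := maxi b cb; rewrite coefXnM ltnNge leq_subr /=.
    by rewrite subKn.
  rewrite big1 // => b _; rewrite coefZ.
  have [->|cb] := eqVneq (c 0 b) 0; first by rewrite !mul0r.
  have Hb := maxi b cb; rewrite coefXnM; case: ifP; rewrite ?mulr0 // => _.
  by rewrite nth_default ?mulr0 //; apply: leq_trans (sM b j) _; lia.
(* With bound 0 the new row i would be zero, against the rank k at the point 0. *)
have di : (0 < delta i)%N.
  rewrite lt0n; apply/eqP => d0.
  have rf : row_free (ev 0 (U *m M)) by rewrite /row_free rUM.
  have : (delta_mx 0 i : 'rV[K]_k) *m ev 0 (U *m M) = 0.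
    apply/rowP=> j; rewrite -rowE !mxE; have := si j; rewrite d0 leqn0 size_poly_eq0.
    by rewrite mxE => /eqP ->; rewrite /horner_eval horner0.
  rewrite -[RHS](mul0mx _ (ev 0 (U *m M))) => /(row_free_inj rf)/rowP/(_ i).
  by rewrite !mxE !eqxx => /eqP; rewrite oner_eq0.
pose delta1 a := if a == i then (delta i).-1 else delta a.
have [|||U' [delta' [rU' uU' sU' lU']]] := IH delta1 _ (U *m M).
- move: ltB; rewrite (bigD1 i) //= [X in _ -> (X < _)%N](bigD1 i) //= {1}/delta1 eqxx.
  rewrite [in X in _ -> (X < _)%N](eq_bigr delta); first lia.
  by move=> a /negbTE; rewrite /delta1 => ->.
- exact: rUM.
- move=> a j; rewrite /delta1; case: eqP => [->|/eqP ne]; first by rewrite prednK.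
  by rewrite UMa.
exists (U' *m U), delta'; rewrite -mulmxA; split=> // t.
by rewrite map_mxM unitmx_mul uU' uU.
Qed.

(** Over an algebraically closed field a polynomial without roots is a nonzero constant. *)
Lemma det_unit_size (k : nat) (U : 'M[{poly K}]_k) :
  (forall t, ev t U \in unitmx) -> size (\det U) = 1%N.
Proof.
move=> uU; apply/eqP; rewrite -[_ == _]negbK; apply/negP => /closed_rootP[x].
by rewrite rootE -/(horner_eval x _) -det_map_mx -[_ == 0]negbK -unitfE -unitmxE uU.
Qed.

(** A nonzero maximal minor of the leading matrix is the coefficient of degree sum of delta in the
    same minor of [U *m M], which differs from that of M by a nonzero constant. *)
Lemma sum_row_degrees (k n : nat) (M : 'M[{poly K}]_(k, n)) (U : 'M[{poly K}]_k) delta :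
  (forall t, ev t U \in unitmx) ->
  (forall i j, (size ((U *m M) i j) <= (delta i).+1)%N) ->
  row_free (leadmx delta (U *m M)) ->
  exists g : {ffun 'I_k -> 'I_n}, (\sum_i delta i <= (size (\det (colsub g M))).-1)%N.
Proof.
move=> uU sUM lUM; have [g _ ug] := full_minor lUM; exists g.
have sg i j : (size (colsub g (U *m M) i j) <= (delta i).+1)%N.
  by rewrite mxE; exact: sUM.
have [_ cg] := coef_det_top sg.
have : (\sum_i delta i < size (\det (colsub g (U *m M))))%N.
  rewrite ltnNge; apply/negP => H; move: cg; rewrite nth_default // => /esym/eqP.
  apply/negP; rewrite -unitfE -unitmxE; suff -> : leadmx delta (colsub g (U *m M)) =
    colsub g (leadmx delta (U *m M)) by [].
  by apply/matrixP=> i j; rewrite !mxE.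
rewrite -mulmx_colsub det_mulmx; have := det_unit_size uU.
move/eqP/size_poly1P => [c c0 ->]; rewrite mul_polyC size_scale // => H.
by rewrite -ltnS (ltn_predK H).
Qed.

(* Row spaces of polynomial matrices specialize: the inclusion for s <> 0 gives the polynomial
   identity  det G * N' = N'_g * adj G * N  with G a minor of N not vanishing at 0. *)
Lemma submx_at_zero (k m n : nat) (N' : 'M[{poly K}]_(m, n)) (N : 'M[{poly K}]_(k, n)) :
  (forall s, s != 0 -> (ev s N' <= ev s N)%MS) -> \rank (ev 0 N) = k ->
  (ev 0 N' <= ev 0 N)%MS.
Proof.
move=> HN rN; have [g _ ug] : exists2 g : {ffun 'I_k -> 'I_n}, injective g
    & colsub g (ev 0 N) \in unitmx by apply: full_minor; rewrite /row_free rN.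
pose G := colsub g N.
have evG s : ev s G = colsub g (ev s N) by apply/matrixP=> i j; rewrite !mxE.
have detG s : (\det G).[s] = \det (ev s G) by rewrite det_map_mx.
have E : \det G *: N' = colsub g N' *m \adj G *m N.
  apply/matrixP=> i j; apply/eqP; rewrite -subr_eq0; set p := _ - _.
  (* The extra factors restrict the test to points s != 0 at which the minor does not vanish. *)
  suff : 'X * \det G * p == 0.
    rewrite !mulf_eq0 polyX_eq0 /= => /orP[/eqP dG|//].
    by move: ug; rewrite -evG unitmxE -detG dG horner0 unitr0.
  apply: contraT => /closed_nonrootP[s]; rewrite rootE !hornerM hornerX.
  rewrite !mulf_eq0 !negb_or => /andP[/andP[s0 ds] /negP[]].
  have /submxP[u Eu] := HN s s0.
  rewrite /p hornerD hornerN subr_eq0; apply/eqP.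
  suff /matrixP/(_ i j) : ev s (\det G *: N') = ev s (colsub g N' *m \adj G *m N).
    by rewrite [LHS]mxE [RHS]mxE.
  have -> : ev s (\det G *: N') = (\det G).[s] *: ev s N'.
    by apply/matrixP=> a b; rewrite !mxE /horner_eval hornerM.
  rewrite !map_mxM.
  have -> : ev s (colsub g N') = u *m ev s G.
    by rewrite evG mulmx_colsub -Eu; apply/matrixP=> a b; rewrite !mxE.
  by rewrite map_mx_adj -(mulmxA u) mul_mx_adj -detG mul_mx_scalar -scalemxAl -Eu.
have := congr1 (ev 0) E; rewrite map_mxM.
have -> : ev 0 (\det G *: N') = (\det G).[0] *: ev 0 N'.
  by apply/matrixP=> a b; rewrite !mxE /horner_eval hornerM.
move=> E0; have d0 : (\det G).[0] != 0 by rewrite detG evG -unitfE -unitmxE.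
by rewrite -(eqmx_scale _ d0) E0 submxMl.
Qed.

End RowReduction.

(** * Kernel and span of a rational curve *)

Section RationalCurves.
Variables (R : realType) (n k : nat).
Local Notation C := R[i].
Implicit Type f : option C -> 'M[C]_n.

(** One row reduced matrix describes f on both charts: its leading matrix gives the value at
    infinity. *)
Definition normal_form f (delta : 'I_k -> nat) (M : 'M[{poly C}]_(k, n)) : Prop :=
  [/\ forall i j, (size (M i j) <= (delta i).+1)%N,
      forall t, (evalmx M t :=: f (Some t))%MS,
      row_free (leadmx delta M) & (leadmx delta M :=: f None)%MS].

(** Row i is s^(delta i) M_i(1/s), the curve in the coordinate s = 1/t at infinity. *)
Definition revmx (delta : 'I_k -> nat) (M : 'M[{poly C}]_(k, n)) : 'M[{poly C}]_(k, n) :=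
  \matrix_(i, j) \poly_(l < (delta i).+1) (M i j)`_(delta i - l).

Lemma revmx0 delta M : evalmx (revmx delta M) 0 = leadmx delta M.
Proof.
by apply/matrixP=> i j; rewrite !mxE horner_coef0 coef_poly /= subn0.
Qed.

Lemma revmx_inv (delta : 'I_k -> nat) (M : 'M[{poly C}]_(k, n)) (s : C) : s != 0 ->
  (forall i j, size (M i j) <= (delta i).+1)%N ->
  (evalmx (revmx delta M) s <= evalmx M (s^-1)%R)%MS.
Proof.
move=> s0 sM; apply/row_subP=> i.
suff -> : row i (evalmx (revmx delta M) s) = s ^+ delta i *: row i (evalmx M s^-1).
  exact/scalemx_sub/row_sub.
apply/rowP=> j; rewrite !mxE horner_poly (horner_coef_wide _ (sM i j)) big_distrr /=.
rewrite (reindex_inj rev_ord_inj) /=; apply: eq_bigr => l _.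
have ld : (l <= delta i)%N by rewrite -ltnS.
rewrite subSS subKn // mulrCA; congr (_ * _).
have -> : s ^+ delta i = s ^+ (delta i - l) * s ^+ l by rewrite -exprD subnK.
by rewrite exprVn mulfK // expf_neq0.
Qed.

Lemma morphism_normal_form d f : morphism_deg k d f ->
  exists (delta : 'I_k -> nat) (M : 'M[{poly C}]_(k, n)),
    normal_form f delta M /\ (\sum_i delta i <= d)%N.
Proof.
move=> [M0 [N [HM0 [HN <-]]]].
pose delta0 (i : 'I_k) := (\max_(j < n) size (M0 i j))%N.
have [||U [delta [rU uU sU lU]]] := @row_reduce _ k n M0 delta0.
- by move=> t; have [] := HM0 t.
- move=> i j; apply: leqW.
  exact: (leq_bigmax_cond (F := fun j => size (M0 i j))).
exists delta, (U *m M0); split; last first.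
  have [g Hg] := sum_row_degrees uU sU lU; apply: leq_trans Hg _.
  exact: (leq_bigmax_cond (F := fun g : {ffun 'I_k -> 'I_n} => (size (\det (colsub g M0))).-1)).
have HU t : (evalmx (U *m M0) t :=: f (Some t))%MS.
  have fU : row_full (map_mx (horner_eval t) U) by rewrite row_full_unit.
  rewrite /evalmx -/(horner_eval t) map_mxM; apply: eqmx_trans (eqmxMfull _ fU) _.
  by have [_ /eqmxP] := HM0 t.
split=> //.
have [rN0 /eqmxP N0] := HN 0; rewrite eqxx in N0.
apply: eqmx_trans N0.
(* Away from s = 0 the reversed matrix has its rows in the row space of N; specialization to 0 gives
   the inclusion, and equal ranks the equality. *)
have sub : (leadmx delta (U *m M0) <= evalmx N 0)%MS.
  rewrite -revmx0; apply: submx_at_zero => // s s0.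
  have [_ /eqmxP Ns] := HN s; rewrite (negbTE s0) in Ns.
  by apply: submx_trans (revmx_inv s0 sU) _; rewrite HU -Ns.
apply/eqmxP; rewrite -(eq_leqif (mxrank_leqif_eq sub)) rN0.
by rewrite (eqP lU).
Qed.

Section NormalForm.
Variables (f : option C -> 'M[C]_n) (delta : 'I_k -> nat) (M : 'M[{poly C}]_(k, n)).
Hypothesis NF : normal_form f delta M.

(** A row with degree bound 0 is constant and equals its leading row, so it lies in every value of
    f. *)
Lemma constant_rows_sub (x : option C) :
  (coordsp _ [set i | delta i == 0%N] *m leadmx delta M <= f x)%MS.
Proof.
have [sM Mf _ Lf] := NF; apply/row_subP=> i.
have -> : row i (coordsp _ [set i | delta i == 0%N] *m leadmx delta M) =
    (delta i == 0%N)%:R *: row i (leadmx delta M).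
  by apply/rowP=> j; rewrite /coordsp mul_diag_mx !mxE inE.
case: eqP => [d0|_]; last by rewrite scale0r sub0mx.
rewrite scale1r; case: x => [t|]; last by rewrite -Lf row_sub.
suff -> : row i (leadmx delta M) = row i (evalmx M t) by rewrite -Mf row_sub.
apply/rowP=> j; rewrite !mxE d0; have := sM i j; rewrite d0 => /size1_polyC E.
by rewrite [in RHS]E hornerC.
Qed.

Lemma card_constant_rows : (k <= #|[set i | delta i == 0%N]| + \sum_i delta i)%N.
Proof.
rewrite -[X in (X <= _)%N](card_ord k) -sum1_card -sum1_card [X in (_ <= X + _)%N]big_mkcond.
rewrite -big_split /=; apply: leq_sum => i _; rewrite inE.
by case: eqP => // /eqP; rewrite -lt0n.
Qed.

Lemma constant_rows_rank A : isKer f A -> (#|[set i | delta i == 0%N]| <= \rank A)%N.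
Proof.
move=> [_ HA]; have [_ _ lM _] := NF.
apply: leq_trans (leq_rank_coordsp C _) _; rewrite -(mxrankMfree _ lM).
have := HA <<coordsp C [set i | delta i == 0%N] *m leadmx delta M>>%MS.
rewrite genmxE => H; apply: mxrankS; apply: H => x; rewrite genmxE.
exact: constant_rows_sub.
Qed.

(** All values of f lie in the span of the coefficient vectors, of which row i has delta i + 1. *)
Lemma span_rank B : isSpan f B -> (\rank B <= k + \sum_i delta i)%N.
Proof.
move=> [_ HB]; have [sM Mf _ Lf] := NF.
pose S := (\sum_(i < k) \sum_(l < (delta i).+1) <<row i (map_mx (coefp l) M)>>)%MS.
have inS i (l : nat) : (l <= delta i)%N -> (row i (map_mx (coefp l) M) <= S)%MS.
  rewrite -ltnS => ld.
  apply: (sumsmx_sup i) => //; apply: (sumsmx_sup (Ordinal ld)) => //=.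
  by rewrite genmxE.
have BS : (B <= S)%MS.
  apply: HB => -[t|]; last first.
    rewrite -Lf; apply/row_subP=> i.
    suff -> : row i (leadmx delta M) = row i (map_mx (coefp (delta i)) M) by apply: inS.
    by apply/rowP=> j; rewrite !mxE.
  rewrite -Mf; apply/row_subP=> i.
  have -> : row i (evalmx M t) =
      \sum_(l < (delta i).+1) t ^+ l *: row i (map_mx (coefp l) M).
    apply/rowP=> j; rewrite !mxE (horner_coef_wide _ (sM i j)) summxE.
    by apply: eq_bigr => l _; rewrite !mxE mulrC.
  by apply: summx_sub => l _; apply/scalemx_sub/inS; rewrite -ltnS.
apply: leq_trans (mxrankS BS) _.
have le_sum (J : finType) (X : J -> 'M[C]_n) (c : J -> nat) :
    (forall j, (\rank (X j) <= c j)%N) -> (\rank (\sum_j X j)%MS <= \sum_j c j)%N.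
  move=> HX; elim/big_ind2: _ => [|x1 x2 y1 y2 H1 H2|//]; first by rewrite mxrank0.
  have [le _] := mxrank_adds_leqif x1 y1; apply: leq_trans le _; exact: leq_add.
have -> : (k + \sum_i delta i = \sum_(i < k) \sum_(l < (delta i).+1) 1)%N.
  transitivity (\sum_(i < k) (1 + delta i))%N; first by rewrite big_split /= sum1_card card_ord.
  by apply: eq_bigr => i _; rewrite sum1_card card_ord add1n.
apply: (le_sum) => i; apply: (le_sum) => l; rewrite mxrank_gen; exact: rank_leq_row.
Qed.

End NormalForm.

Lemma kerspan_rank d f A B : morphism_deg k d f -> isKer f A -> isSpan f B ->
  (k <= \rank A + d)%N /\ (\rank B <= k + d)%N.
Proof.
move=> /morphism_normal_form[delta [M [NF Hd]]] HA HB.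
have := card_constant_rows delta; have := constant_rows_rank NF HA.
have := span_rank NF HB; move: Hd.
move: (\rank A) (\rank B) (\sum_i _)%N #|_| => x y z w; lia.
Qed.

(** At most k - d rows are constant and the degrees add up to at most d, so every row has degree at
    most 1; q collects the linear coefficients. *)
Lemma morphism_pencil d f A : morphism_deg k d f -> isKer f A -> (\rank A + d <= k)%N ->
  exists p q : 'M[C]_(k, n),
    (forall t, ((p + t *: q)%R :=: f (Some t))%MS) /\ (q <= f None)%MS.
Proof.
move=> /morphism_normal_form[delta [M [NF Hd]]] HA rA.
have [sM Mf _ Lf] := NF.
have d1 i : (delta i <= 1)%N.
  (* The predecessor of 0 is 0, so this sum is the total excess of the degrees over 1. *)
  have : (\sum_i (delta i).-1 == 0)%N.
    have := constant_rows_rank NF HA.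
    have : (#|[set i | delta i == 0%N]| + \sum_i delta i = k + \sum_i (delta i).-1)%N.
      transitivity (\sum_(j < k) (1 + (delta j).-1))%N; last first.
        by rewrite big_split /= sum1_card card_ord.
      rewrite -sum1_card [X in (X + _)%N]big_mkcond -big_split /=.
      by apply: eq_bigr => j _; rewrite inE; case: (delta j).
    move: Hd rA; move: (\rank A) (\sum_i delta i)%N (\sum_i (delta i).-1)%N #|_| => x y z w; lia.
  by rewrite sum_nat_eq0 => /forallP/(_ i); lia.
have sM2 i j : (size (M i j) <= 2)%N by apply: leq_trans (sM i j) _; rewrite ltnS.
exists (map_mx (coefp 0) M), (map_mx (coefp 1) M); split=> [t|].
  apply: eqmx_trans (Mf t).
  suff -> : evalmx M t = map_mx (coefp 0) M + t *: map_mx (coefp 1) M by exact: eqmx_refl.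
  apply/matrixP=> i j; rewrite !mxE (horner_coef_wide _ (sM2 i j)).
  by rewrite 2!big_ord_recl big_ord0 /= !mulr1 addr0 mulrC.
rewrite -Lf; apply/row_subP=> i.
have := d1 i; case E: (delta i) => [|[|//]] _.
  suff -> : row i (map_mx (coefp 1) M) = 0 by rewrite sub0mx.
  apply/rowP=> j; rewrite !mxE /= nth_default //; have := sM i j; by rewrite E.
suff -> : row i (map_mx (coefp 1) M) = row i (leadmx delta M) by apply: row_sub.
by apply/rowP=> j; rewrite !mxE E.
Qed.

(* For rows p' + q' = u (p + q) the difference p' - u p = u q - q' lies in
   f(0) /\ f(oo) = A, so p' + t q' lies in f(t). *)
Lemma morphism_eq d f g A : morphism_deg k d f -> morphism_deg k d g ->
  isKer f A -> isKer g A -> (\rank A + d <= k)%N ->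
  (f (Some 0%R) == g (Some 0%R))%MS -> (f (Some 1%R) == g (Some 1%R))%MS ->
  (f None == g None)%MS -> (f (Some 0%R) :&: f None <= A)%MS ->
  forall x, (f x == g x)%MS.
Proof.
move=> mf mg Kf Kg rA /eqmxP E0 /eqmxP E1 /eqmxP Eoo cap.
have [p [q [Hf qf]]] := morphism_pencil mf Kf rA.
have [p' [q' [Hg qg]]] := morphism_pencil mg Kg rA.
have rk h t : morphism_deg k d h -> \rank (h (Some t)) = k.
  by case=> [M [N [HM _]]]; have [r /eqmxP <-] := HM t.
case=> [t|]; last by apply/eqmxP.
have p0 : (p <= f (Some 0%R))%MS by rewrite -Hf scale0r addr0.
have p'0 : (p' <= f (Some 0%R))%MS by rewrite E0 -Hg scale0r addr0.
have : ((p' + q')%R <= (p + q)%R)%MS.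
  by have := Hf 1; have := Hg 1; rewrite !scale1r => -> ->; rewrite E1.
case/submxP => u; rewrite mulmxDr => Eu.
pose W := p' - u *m p.
have EW : W = u *m q - q'.
  by rewrite /W -[p'](addrK q') Eu addrAC [u *m p + _]addrC addrK.
have WA : (W <= A)%MS.
  apply: submx_trans cap; rewrite sub_capmx; apply/andP; split.
    by rewrite /W addmx_sub ?eqmx_opp ?mulmx_sub.
  by rewrite EW addmx_sub ?eqmx_opp ?mulmx_sub // Eoo.
have gf : (g (Some t) <= f (Some t))%MS.
  rewrite -Hg; have -> : p' + t *: q' = u *m (p + t *: q) + (1 - t) *: W.
    have -> : p' = W + u *m p by rewrite subrK.
    have -> : q' = u *m q - W by rewrite EW opprB addrC subrK.
    rewrite mulmxDr scalerBr scalerBl scale1r -scalemxAr.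
    by rewrite [W + _]addrC addrACA.
  apply: addmx_sub; first by rewrite -Hf submxMl.
  by apply/scalemx_sub/(submx_trans WA); case: Kf.
by rewrite gf andbT; have [_ <-] := mxrank_leqif_sup gf; rewrite !rk.
Qed.

End RationalCurves.

(** * The curve through three given subspaces *)

Section PencilExistence.
Variables (R : realType) (n c d : nat).
Local Notation C := R[i].

(** Split a basis p0 of a complement of A in V1 along V2 + V3 = B, and let -q0 be its part in V3.
    Then p0 + q0 lies in V2, and A + <p0 + t q0> passes through V1, V2, V3 at 0, 1, infinity. *)
Lemma pencil_exists (A B V1 V2 V3 : 'M[C]_n) :
  \rank A = c -> \rank V1 = (c + d)%N -> \rank V2 = (c + d)%N -> \rank V3 = (c + d)%N ->
  \rank B = (c + d + d)%N ->
  (A <= V1)%MS -> (A <= V2)%MS -> (A <= V3)%MS ->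
  (V1 <= B)%MS -> (V2 <= B)%MS -> (V3 <= B)%MS ->
  (V1 :&: V2 <= A)%MS -> (V1 :&: V3 <= A)%MS -> (V2 :&: V3 <= A)%MS ->
  exists f : option C -> 'M[C]_n,
    [/\ morphism_deg (c + d) d f, (f (Some 0%R) :=: V1)%MS, (f (Some 1%R) :=: V2)%MS
      & (f None :=: V3)%MS] /\ isKer f A /\ isSpan f B.
Proof.
move=> rA r1 r2 r3 rB A1 A2 A3 B1 B2 B3 c12 c13 c23.
have sumB (V W : 'M[C]_n) : \rank V = (c + d)%N -> \rank W = (c + d)%N ->
    (V <= B)%MS -> (W <= B)%MS -> (V :&: W <= A)%MS -> (B <= V + W)%MS.
  move=> rV rW VB WB VW; have VWB : (V + W <= B)%MS by rewrite addsmx_sub VB.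
  have [_ <-] := mxrank_leqif_sup VWB; rewrite eqn_leq mxrankS //=.
  have := mxrank_sum_cap V W; rewrite rV rW rB; have := mxrankS VW; rewrite rA.
  move: (\rank (V + W)%MS) (\rank (V :&: W)%MS) => x y; lia.
pose alpha : 'M[C]_(c, n) := castmx (rA, erefl n) (row_base A).
have Ealpha : (alpha :=: A)%MS := eqmx_trans (eqmx_cast _ _) (eq_row_base A).
have rD : \rank (V1 :\: A)%MS = d.
  have := mxrank_cap_compl V1 A; rewrite (capmx_idPr A1) rA r1; move: (\rank _) => x; lia.
pose p0 : 'M[C]_(d, n) := castmx (rD, erefl n) (row_base (V1 :\: A)%MS).
have Ep0 : (p0 :=: V1 :\: A)%MS := eqmx_trans (eqmx_cast _ _) (eq_row_base _).
have p0V1 : (p0 <= V1)%MS by rewrite Ep0 diffmxSl.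
have p0free (v : 'rV_d) : (v *m p0 <= A)%MS -> v = 0.
  move=> vA; have fp : row_free p0 by rewrite /row_free Ep0 rD.
  apply: (row_free_inj fp); rewrite mul0mx; apply/eqP; rewrite -submx0.
  by rewrite -(capmx_diff V1 A) sub_capmx vA -Ep0 submxMl.
have /sub_addsmxP[[u2 u3] /= Eu] : (p0 <= V2 + V3)%MS.
  by apply: submx_trans (sumB _ _ r2 r3 B2 B3 c23); apply: submx_trans p0V1 B1.
pose q0 : 'M[C]_(d, n) := - (u3 *m V3).
have q0V3 : (q0 <= V3)%MS by rewrite eqmx_opp submxMl.
have pqV2 : ((p0 + q0)%R <= V2)%MS by rewrite Eu addrK submxMl.
(* In a relation v, the vector x v2 p0 lies in both V1 and V3, hence in A. For x = 0 instead v2 q0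
   lies in A, so v2 p0 lies in V2 as well as V1. *)
have rk (x z : C) : (x != 0) || (z != 0) ->
    \rank (col_mx alpha (x *: p0 + z *: q0)) = (c + d)%N.
  move=> xz; apply/eqP; apply: inj_row_free => v.
  rewrite -[v]hsubmxK mul_row_col; set v1 := lsubmx v; set v2 := rsubmx v => E.
  have xA : (x *: (v2 *m p0) <= A)%MS.
    apply: submx_trans c13; rewrite sub_capmx; apply/andP; split.
      by apply/scalemx_sub/mulmx_sub.
    have -> : x *: (v2 *m p0) = - (z *: (v2 *m q0)) - v1 *m alpha.
      apply/eqP; rewrite -opprD -addr_eq0; apply/eqP.
      by rewrite -[RHS]E mulmxDr -!scalemxAr addrA addrC.
    apply: addmx_sub; first by rewrite eqmx_opp; apply/scalemx_sub/mulmx_sub.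
    by rewrite eqmx_opp; apply: mulmx_sub; rewrite Ealpha.
  have v20 : v2 = 0.
    have [x0|x0] := eqVneq x 0; last by apply: p0free; rewrite -(eqmx_scale _ x0).
    move: xz; rewrite x0 eqxx /= => z0.
    have qA : (v2 *m q0 <= A)%MS.
      rewrite -(eqmx_scale _ z0); have -> : z *: (v2 *m q0) = - (v1 *m alpha).
        apply/eqP; rewrite -addr_eq0 addrC; apply/eqP.
        by rewrite -[RHS]E x0 scale0r add0r scalemxAr.
      by rewrite eqmx_opp; apply: mulmx_sub; rewrite Ealpha.
    apply: p0free; apply: submx_trans c12; rewrite sub_capmx mulmx_sub //=.
    have -> : v2 *m p0 = v2 *m (p0 + q0) - v2 *m q0 by rewrite mulmxDr addrK.
    by apply: addmx_sub; [apply: mulmx_sub | rewrite eqmx_opp (submx_trans qA A2)].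
  have v10 : v1 = 0.
    have fa : row_free alpha by rewrite /row_free Ealpha rA.
    by apply: (row_free_inj fa); rewrite mul0mx -[RHS]E v20 mul0mx addr0.
  by rewrite v10 v20 row_mx0.
pose M : 'M[{poly C}]_(c + d, n) :=
  col_mx (map_mx polyC alpha) (map_mx polyC p0 + 'X *: map_mx polyC q0).
pose N : 'M[{poly C}]_(c + d, n) :=
  col_mx (map_mx polyC alpha) ('X *: map_mx polyC p0 + map_mx polyC q0).
have evM t : evalmx M t = col_mx alpha (p0 + t *: q0).
  rewrite /evalmx map_col_mx; congr col_mx; apply/matrixP=> i j; rewrite !mxE ?hornerC //.
  by rewrite hornerD hornerC hornerM hornerX hornerC.
have evN s : evalmx N s = col_mx alpha (s *: p0 + q0).
  rewrite /evalmx map_col_mx; congr col_mx; apply/matrixP=> i j; rewrite !mxE ?hornerC //.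
  by rewrite hornerD hornerC hornerM hornerX hornerC.
have rM t : \rank (col_mx alpha (p0 + t *: q0)) = (c + d)%N.
  by have := rk 1 t; rewrite scale1r oner_neq0; apply.
have rN s : \rank (col_mx alpha (s *: p0 + q0)) = (c + d)%N.
  by have := rk s 1; rewrite scale1r oner_neq0 orbT; apply.
pose f (x : option C) : 'M[C]_n :=
  if x is Some t then <<col_mx alpha (p0 + t *: q0)>>%MS else <<col_mx alpha q0>>%MS.
have eqV (V : 'M[C]_n) (W : 'M[C]_(c + d, n)) : \rank V = (c + d)%N ->
    \rank W = (c + d)%N -> (W <= V)%MS -> (<<W>> :=: V)%MS.
  move=> rV rW WV; apply: eqmx_trans (genmxE W) _.
  by apply/eqmxP; rewrite -(eq_leqif (mxrank_leqif_eq WV)) rV rW.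
have f0 : (f (Some 0%R) :=: V1)%MS.
  by apply: eqV => //; rewrite scale0r addr0 col_mx_sub Ealpha A1.
have f1 : (f (Some 1%R) :=: V2)%MS.
  by apply: eqV => //; rewrite scale1r col_mx_sub Ealpha A2.
have foo : (f None :=: V3)%MS.
  apply: eqV => //; last by rewrite col_mx_sub Ealpha A3.
  by have := rN 0; rewrite scale0r add0r.
exists f; split; last split.
- split=> //; exists M, N; split; [|split].
  + by move=> t; rewrite evM rM; split=> //; apply/eqmxP/eqmx_sym/genmxE.
  + move=> s; rewrite evN rN; split=> //; apply/eqmxP; have [->|s0] := eqVneq s 0.
      by rewrite scale0r add0r; apply/eqmx_sym/genmxE.
    apply: eqmx_trans (eqmx_sym (genmxE _)).
    apply: eqmx_trans (eqmx_sym (addsmxE _ _)) _; apply: eqmx_trans (addsmxE _ _).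
    apply: adds_eqmx => //; have -> : s *: p0 + q0 = s *: (p0 + s^-1 *: q0).
      by rewrite scalerDr scalerA divff // scale1r.
    exact: eqmx_scale.
  (* The rows of A have degree 0 and the d others degree at most 1; the leading matrix is the value
     at infinity, of full rank, so some maximal minor has degree exactly d. *)
  + pose delta (i : 'I_(c + d)) : nat := if split i is inr _ then 1%N else 0%N.
    have Sd : (\sum_i delta i = d)%N.
      rewrite big_split_ord /= big1 => [|i _]; last by rewrite /delta (unsplitK (inl i)).
      rewrite add0n -[RHS](card_ord d) -sum1_card; apply: eq_bigr => i _.
      by rewrite /delta (unsplitK (inr i)).
    have sM i j : (size (M i j) <= (delta i).+1)%N.
      rewrite /delta /M; case: split_ordP => l ->.
        by rewrite col_mxEu mxE size_polyC leq_b1.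
      rewrite col_mxEd !mxE; apply: leq_trans (size_polyD _ _) _.
      rewrite geq_max size_polyC (leq_trans (leq_b1 _)) //=.
      apply: leq_trans (size_polyMleq _ _) _; rewrite size_polyX size_polyC.
      by case: (_ != 0).
    have lM : leadmx delta M = col_mx alpha q0.
      apply/matrixP=> i j; rewrite !mxE /delta.
      case: split_ordP => l _; first by rewrite !mxE coefC.
      by rewrite !mxE coefD coefC coefXM coefC add0r.
    have sg (g : {ffun 'I_(c + d) -> 'I_n}) i j :
        (size (colsub g M i j) <= (delta i).+1)%N by rewrite mxE; apply: sM.
    apply/eqP; rewrite eqn_leq; apply/andP; split.
      apply/bigmax_leqP => g _; have [+ _] := coef_det_top (sg g).
      by rewrite Sd; case: (size _).
    have fl : row_free (leadmx delta M).
      by rewrite /row_free lM; have := rN 0; rewrite scale0r add0r => ->.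
    have [g _ ug] := full_minor fl.
    apply: leq_trans (leq_bigmax_cond (F := fun g : {ffun 'I_(c + d) -> 'I_n} =>
      (size (\det (colsub g M))).-1) g isT) => /=.
    have [_] := coef_det_top (sg g); rewrite Sd => cg.
    have H : (d < size (\det (colsub g M)))%N.
      rewrite ltnNge; apply/negP => H; move: cg; rewrite nth_default // => /esym/eqP.
      apply/negP; rewrite -unitfE -unitmxE; suff -> : leadmx delta (colsub g M) =
        colsub g (leadmx delta M) by [].
      by apply/matrixP=> i j; rewrite !mxE.
    by rewrite -ltnS (ltn_predK H).
- split=> [x|T HT].
    by rewrite -Ealpha; case: x => [t|] /=; rewrite genmxE -addsmxE addsmxSl.
  by apply: submx_trans c13; rewrite sub_capmx -f0 -foo !HT.
- split=> [x|T HT].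
    case: x => [t|] /=; last by rewrite -/(f None) foo.
    rewrite genmxE col_mx_sub Ealpha (submx_trans A1 B1) /=.
    rewrite addmx_sub ?scalemx_sub ?(submx_trans p0V1) //.
    exact: submx_trans q0V3 B3.
  apply: submx_trans (sumB _ _ r1 r3 B1 B3 c13) _.
  by rewrite addsmx_sub -f0 -foo !HT.
Qed.

End PencilExistence.

(** * Bijectivity of the kernel-span map for generic flags *)

(** A' is any space of dimension one above A inside V1 :&: V2; an excess intersection is impossible
    for d = 0, where A already has the rank of V1. *)
Lemma nontransverse_config (R : realType) (n k d : nat) (lam mu nu : seq nat)
    (F G H A B V1 V2 V3 : 'M[R[i]]_n) :
  F \in unitmx -> G \in unitmx -> H \in unitmx ->
  (d <= k)%N -> \rank A = (k - d)%N -> \rank B = (k + d)%N ->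
  (A <= V1)%MS -> (A <= V2)%MS -> (A <= V3)%MS ->
  (V1 <= B)%MS -> (V2 <= B)%MS -> (V3 <= B)%MS ->
  inSchubert k lam F V1 -> inSchubert k mu G V2 -> inSchubert k nu H V3 ->
  (\rank A < \rank (V1 :&: V2)%MS)%N ->
  (0 < d)%N /\ config k (k - d) 1 (k + d) lam mu nu F G H.
Proof.
move=> uF uG uH dk rA rB A1 A2 A3 B1 B2 B3 S1 S2 S3 lt.
have [r1 _] := S1; have c12 : (A <= V1 :&: V2)%MS by rewrite sub_capmx A1.
split.
  have := mxrankS (capmxSl V1 V2); move: lt; rewrite r1 rA.
  move: (\rank _) => x; lia.
have [|A' [AA' A'V rA']] := @intermediate_subspace _ _ _ _ (\rank A).+1 _ _ c12.
  by rewrite leqnSn.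
split=> //; exists A, A', B, V1, V2, V3; split; first by rewrite rA' addn1 -rA.
split; last by split.
by move: A'V; rewrite sub_capmx => /andP[].
Qed.

Lemma inSchubert_eqmx (R : realType) (n k : nat) lam (F V W : 'M[R[i]]_n) :
  (V :=: W)%MS -> inSchubert k lam F W -> inSchubert k lam F V.
Proof.
move=> E [rW HW]; split=> [|i /HW]; first by rewrite E.
by rewrite (cap_eqmx E (eqmx_refl _)).
Qed.

(* "F, G, H in general position": there is a nonempty Zariski-open set of
   triples of complete flags (given by invertible matrices), namely the
   non-vanishing locus of a nonzero polynomial P in the 3n^2 entries, on
   which the conclusion holds. *)
Theorem mainTheorem2 (R : realType) (n k d : nat) (lam mu nu : seq nat) :
  (1 <= k)%N -> (k < n)%N ->
  is_part k (n - k) lam -> is_part k (n - k) mu -> is_part k (n - k) nu ->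
  (sumn lam + sumn mu + sumn nu = k * (n - k) + n * d)%N ->
  exists P : {mpoly R[i][n * n + n * n + n * n]},
    P != 0 /\
    forall F G H : 'M[R[i]]_n,
      F \in unitmx -> G \in unitmx -> H \in unitmx ->
      P.@[flag_coords F G H] != 0 ->
      kerspan_bij k d lam mu nu F G H.
Proof.
move=> k1 kn Hlam Hmu Hnu Hsum.
have [P [P0 HP]] := generic_flags R k1 kn Hlam Hmu Hnu Hsum.
exists P; split=> // F G H uF uG uH /HP[dims trans] {P P0 HP}.
(* Genericity, applied to each pair of flags, bounds all pairwise intersections. *)
have tr (A B V1 V2 V3 : 'M[R[i]]_n) : (d <= k)%N -> \rank A = (k - d)%N -> \rank B = (k + d)%N ->
    (A <= V1)%MS -> (A <= V2)%MS -> (A <= V3)%MS ->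
    (V1 <= B)%MS -> (V2 <= B)%MS -> (V3 <= B)%MS ->
    inSchubert k lam F V1 -> inSchubert k mu G V2 -> inSchubert k nu H V3 ->
    [/\ \rank (V1 :&: V2)%MS <= \rank A, \rank (V1 :&: V3)%MS <= \rank A
      & \rank (V2 :&: V3)%MS <= \rank A]%N.
  move=> dk rA rB A1 A2 A3 B1 B2 B3 S1 S2 S3.
  have kdn : (k + d <= n)%N by rewrite -rB rank_leq_col.
  split; rewrite leqNgt; apply/negP => lt.
  - have [d0 cf] := nontransverse_config uF uG uH dk rA rB A1 A2 A3 B1 B2 B3 S1 S2 S3 lt.
    by case: (trans d0 dk kdn).
  - have [d0 cf] := nontransverse_config uF uH uG dk rA rB A1 A3 A2 B1 B3 B2 S1 S3 S2 lt.
    by case: (trans d0 dk kdn).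
  rewrite capmxC in lt.
  have [d0 cf] := nontransverse_config uH uG uF dk rA rB A3 A2 A1 B3 B2 B1 S3 S2 S1 lt.
  by case: (trans d0 dk kdn).
have capA (A V W : 'M[R[i]]_n) : (A <= V)%MS -> (A <= W)%MS ->
    (\rank (V :&: W)%MS <= \rank A)%N -> (V :&: W <= A)%MS.
  move=> AV AW le; have AVW : (A <= V :&: W)%MS by rewrite sub_capmx AV.
  by have [_ <-] := mxrank_leqif_sup AVW; rewrite eqn_leq le mxrankS.
pose S (f : option R[i] -> 'M[R[i]]_n) :=
  morphism_deg k d f /\ inSchubert k lam F (f (Some 0)) /\
  inSchubert k mu G (f (Some 1)) /\ inSchubert k nu H (f None).
(* The values at 0, 1 and infinity form a configuration with e = 0 between Ker and Span; genericity
   leaves only the extremal dimensions. *)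
have Sdims f A B : S f -> isKer f A -> isSpan f B ->
    [/\ (d <= k)%N, (k + d <= n)%N, \rank A = (k - d)%N & \rank B = (k + d)%N].
  move=> [mf [S1 [S2 S3]]] KA SB.
  have [kA kB] := kerspan_rank mf KA SB; have [Af _] := KA; have [fB _] := SB.
  have [r1 _] := S1.
  have Ak : (\rank A <= k)%N by rewrite -r1 mxrankS.
  have Bk : (k <= \rank B)%N by rewrite -r1 mxrankS.
  have Bn : (\rank B <= n)%N := rank_leq_col B.
  have [|EA EB] := dims _ _ Ak Bk Bn kA kB.
    split=> //; exists A, A, B, (f (Some 0)), (f (Some 1)), (f None).
    split; first by rewrite addn0.
    by split; [|split]; split.
  by split; [lia | rewrite -EB | lia | ].
split; [|split].
- move=> f Sf A B KA SB; have [dk kdn rA rB] := Sdims f A B Sf KA SB.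
  have [mf [S1 [S2 S3]]] := Sf; have [Af _] := KA; have [fB _] := SB.
  have Y : inYd k d A B by do !split=> //; apply: submx_trans (Af None) (fB None).
  by split; [|split]; split=> //; eexists; split; eauto.
- move=> f g Sf Sg A B KfA SfB KgA SgB; have [dk kdn rA rB] := Sdims f A B Sf KfA SfB.
  have [mf [S1 [S2 S3]]] := Sf; have [Af _] := KfA; have [fB _] := SfB.
  have [mg [S1' [S2' S3']]] := Sg; have [Ag _] := KgA; have [gB _] := SgB.
  have [c12 c13 c23] := tr A B _ _ _ dk rA rB (Af _) (Af _) (Af _) (fB _) (fB _) (fB _) S1 S2 S3.
  have [r1 _] := S1; have [r2 _] := S2.
  apply: (morphism_eq mf mg KfA KgA); first by rewrite rA subnK.
  (* If f and g differed at 0, [schubert_pencil] would give a V in the Schubert variety of F meeting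
     f(1) in more than A, against [tr]; the points 1 and infinity are alike. *)
  + apply: contraT => ne.
    have [V [SV AV VB]] := schubert_pencil uF dk rA rB (Af _) (fB _) (Ag _) (gB _)
      (Af (Some 1)) (fB _) r2 S1 S1' ne.
    have [+ _ _] := tr A B _ _ _ dk rA rB AV (Af _) (Af _) VB (fB _) (fB _) SV S2 S3.
    by rewrite leqNgt => /negP.
  + apply: contraT => ne.
    have [V [SV AV VB]] := schubert_pencil uG dk rA rB (Af _) (fB _) (Ag _) (gB _)
      (Af (Some 0)) (fB _) r1 S2 S2' ne.
    have [+ _ _] := tr A B _ _ _ dk rA rB (Af _) AV (Af _) (fB _) VB (fB _) S1 SV S3.
    by rewrite capmxC leqNgt => /negP.
  + apply: contraT => ne.
    have [V [SV AV VB]] := schubert_pencil uH dk rA rB (Af _) (fB _) (Ag _) (gB _)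
      (Af (Some 0)) (fB _) r1 S3 S3' ne.
    have [_ + _] := tr A B _ _ _ dk rA rB (Af _) (Af _) AV (fB _) (fB _) VB S1 S2 SV.
    by rewrite capmxC leqNgt => /negP.
  exact: capA.
(* Surjectivity: the three spaces witnessing membership of (A, B) meet pairwise in A, so a pencil
   passes through them. *)
move=> A B [[[dk [kdn [rA [rB AB]]]] [V1 [S1 [A1 B1]]]]
            [[_ [V2 [S2 [A2 B2]]]] [_ [V3 [S3 [A3 B3]]]]]].
have [c12 c13 c23] := tr A B _ _ _ dk rA rB A1 A2 A3 B1 B2 B3 S1 S2 S3.
have Ek : (k - d + d = k)%N by rewrite subnK.
have [r1 _] := S1; have [r2 _] := S2; have [r3 _] := S3.
have := @pencil_exists R n (k - d) d A B V1 V2 V3 rA; rewrite Ek.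
case=> //; try exact: capA.
move=> f [[mf f0 f1 foo] [KA SB]]; exists f; split=> //; split=> //; split.
  exact: inSchubert_eqmx f0 S1.
by split; [exact: inSchubert_eqmx f1 S2 | exact: inSchubert_eqmx foo S3].
Qed.
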